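(* Assume that $\mathbf{(H_b)}$ holds, with $\xi\in(0,1]$ given by $\mathbf{(H_b^2)}$ and $\vartheta\ge 0$ given by $\mathbf{(H_b^{3,\vartheta})}$. If $\vartheta<\xi/2$, then the sequence of estimators $(\hat\phi^u_{\boldsymbol{l_u},n_1})_{u,\boldsymbol{l_u}}$ satisfies $$\sup_{u,\ \boldsymbol{l_u}}\big\|\hat\phi^u_{\boldsymbol{l_u},n_1}-\phi^u_{\boldsymbol{l_u}}\big\| = \zeta_{n,0}=\mathcal O_P\big(n^{\vartheta-\xi/2}\big),$$ where the first equality defines $\zeta_{n,0}$ and the supremum is over all nonempty $u\subseteq\{1,\dots,p_n\}$ with $|u|\le 2$ and all $\boldsymbol{l_u}\in\{1,\dots,L\}^{|u|}$.
   Context: Setting. For each (even) sample size $n$, $\mathbf X=(X_1,\dots,X_p)$ is a random vector in $\mathbb R^p$, $p=p_n$, with law $P_{\mathbf X}$ having a density with respect to Lebesgue measure; the components may be dependent. $\langle h,g\rangle=\mathbb E[h(\mathbf X)g(\mathbf X)]$ and $\|h\|^2=\langle h,h\rangle$ on $L^2(P_{\mathbf X})$. When an estimated (random) function appears in $\langle\cdot,\cdot\rangle$ or $\|\cdot\|$, the expectation is taken over an independent copy of $\mathbf X$, with the data held fixed. $L\ge1$ is a fixed integer. For each $i$, $(\phi^i_l)_{l\ge0}$ is an orthonormal basis of $L^2(\mathbb R,P_{X_i})$ with $\phi^i_0=1$. Second-order basis functions. For $i\neq j$ and $\boldsymbol{l_{ij}}=(l_i,l_j)\in\{1,\dots,L\}^2$,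 $$\phi^{ij}_{\boldsymbol{l_{ij}}}(x_i,x_j)=\phi^i_{l_i}(x_i)\phi^j_{l_j}(x_j)+\sum_{k=1}^L\lambda^i_{k,\boldsymbol{l_{ij}}}\phi^i_k(x_i)+\sum_{k=1}^L\lambda^j_{k,\boldsymbol{l_{ij}}}\phi^j_k(x_j)+C_{\boldsymbol{l_{ij}}},$$ where the constants are determined by $\langle\phi^{ij}_{\boldsymbol{l_{ij}}},\phi^i_k\rangle=\langle\phi^{ij}_{\boldsymbol{l_{ij}}},\phi^j_k\rangle=0$ for $1\le k\le L$ and $\langle\phi^{ij}_{\boldsymbol{l_{ij}}},1\rangle=0$. Equivalently, $\boldsymbol\lambda^{\boldsymbol{l_{ij}}}=(\lambda^i_{1},\dots,\lambda^i_{L},\lambda^j_{1},\dots,\lambda^j_{L})^t$ solves $A^{ij}\boldsymbol\lambda^{\boldsymbol{l_{ij}}}=D^{\boldsymbol{l_{ij}}}$, where $A^{ij}$ is the $2L\times 2L$ Gram matrix (for $\langle\cdot,\cdot\rangle$) of $(\phi^i_1,\dots,\phi^i_L,\phi^j_1,\dots,\phi^j_L)$ and $D^{\boldsymbol{l_{ij}}}$ is minus the vector of inner products of $\phi^i_{l_i}\phi^j_{l_j}$ with these $2L$ functions; and $C_{\boldsymbol{l_{ij}}}=-\mathbb E\big[\phi^i_{l_i}(X_i)\phi^j_{l_j}(X_j)+\sum_k\lambda^i_k\phi^i_k(X_i)+\sum_k\lambda^j_k\phi^j_k(X_j)\big]$. The family $(\phi^u_{\boldsymbol{l_u}})$, $|u|\le2$,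 consists of the $\phi^i_{l}$ ($u=\{i\}$, $1\le l\le L$) and the $\phi^{ij}_{\boldsymbol{l_{ij}}}$ ($u=\{i,j\}$). Empirical version. From $n_1=n/2$ i.i.d. observations $\mathbf x^1,\dots,\mathbf x^{n_1}$ of $\mathbf X$, let $\langle h,g\rangle_{n_1}=\frac1{n_1}\sum_{r=1}^{n_1}h(\mathbf x^r)g(\mathbf x^r)$. Let $\hat\phi^i_{l,n_1}=\phi^i_l$. Let $\hat A^{ij}_{n_1}$, $\hat D^{\boldsymbol{l_{ij}}}_{n_1}$ be $A^{ij}$, $D^{\boldsymbol{l_{ij}}}$ with $\langle\cdot,\cdot\rangle$ replaced by $\langle\cdot,\cdot\rangle_{n_1}$; $\hat{\boldsymbol\lambda}^{\boldsymbol{l_{ij}}}_{n_1}$ solves $\hat A^{ij}_{n_1}\hat{\boldsymbol\lambda}^{\boldsymbol{l_{ij}}}_{n_1}=\hat D^{\boldsymbol{l_{ij}}}_{n_1}$ (set to $0$ if $\hat A^{ij}_{n_1}$ is singular); $\hat C^{n_1}_{\boldsymbol{l_{ij}}}$ is given by the formula for $C_{\boldsymbol{l_{ij}}}$ with $\mathbb E$ replaced by the empirical mean over $\mathbf x^1,\dots,\mathbf x^{n_1}$ and $\boldsymbol\lambda$ by $\hat{\boldsymbol\lambda}_{n_1}$; and $\hat\phi^{ij}_{\boldsymbol{l_{ij}},n_1}$ is defined as $\phi^{ij}_{\boldsymbol{l_{ij}}}$ with these estimated constants. Assumption $\mathbf{(H_b)}$ is the conjunction of: $\mathbf{(H_b^1)}$: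 $M:=\sup_{1\le i\le p_n,\,1\le l\le L}\|\phi^i_l(X_i)\|_\infty<\infty$ (uniformly in $n$); $\mathbf{(H_b^2)}$: $p_n=\mathcal O(\exp(Cn^{1-\xi}))$ as $n\to\infty$, for some $0<\xi\le1$ and $C>0$; $\mathbf{(H_b^{3,\vartheta})}$: there is $C>0$ such that $\det(A^{ij})\ge Cn^{-\vartheta}$ for all $i\ne j$ in $\{1,\dots,p_n\}$ and all $n$. $Z_n=\mathcal O_P(a_n)$ means that $|Z_n/a_n|$ is bounded in probability. *)

(* Defs.v *)
From HB Require Import structures.
From mathcomp Require Import all_boot all_order all_algebra.
From mathcomp Require Import all_classical all_reals all_analysis.
Set Implicit Arguments.
Unset Strict Implicit.
Unset Printing Implicit Defensive.
Import Order.TTheory GRing.Theory Num.Theory.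
Import numFieldNormedType.Exports.
Local Open Scope classical_set_scope.
Local Open Scope ring_scope.

(* The sequences below are indexed by nat, but nothing is assumed or claimed
   about the terms whose index is not a sample size. *)
Definition sample_size (n : nat) : bool := (0 < n)%N && ~~ odd n.

Section law.
Context {R : realType} {p : nat}.

Definition coord (i : 'I_p) (x : p.-tuple R) : R := tnth x i.

Lemma measurable_coord (i : 'I_p) : measurable_fun setT (coord i).
Proof. exact: measurable_tnth. Qed.

HB.instance Definition _ (i : 'I_p) :=
  isMeasurableFun.Build _ _ _ _ (coord i) (measurable_coord i).

Definition marginal (PX : probability (p.-tuple R) R) (i : 'I_p) :
  probability R R := distribution PX (coord i).

End law.

(* Integral of a nonnegative measurable function with respect to the Lebesgue
   measure of R^p, written as an iterated integral (Tonelli). *)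
Fixpoint lebesgue_iint {R : realType} (p : nat) :
    (p.-tuple R -> \bar R) -> \bar R :=
  match p with
  | 0 => fun f => f [tuple]
  | q.+1 => fun f =>
      (\int[lebesgue_measure]_t lebesgue_iint (fun x => f [tuple of t :: x]))%E
  end.

Definition has_lebesgue_density {R : realType} {p : nat}
    (PX : probability (p.-tuple R) R) : Prop :=
  exists f : p.-tuple R -> R,
    [/\ measurable_fun setT f, forall x, 0 <= f x &
        forall A, measurable A ->
          PX A = lebesgue_iint (fun x => (f x * \1_A x)%:E)].

Definition orthonormal_basis {R : realType} (mu : probability R R)
    (phi : nat -> R -> R) : Prop :=
  [/\ forall l, phi l \in Lfun mu 2%:E,
      forall k l, \int[mu]_x (phi k x * phi l x) = (k == l)%:R &
      forall f, f \in Lfun mu 2%:E -> forall e : R, 0 < e ->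
        exists (m : nat) (c : nat -> R),
          ('N[mu]_2%:E[EFin \o (fun x => f x - \sum_(l < m) c l * phi l x)%R]
             < e%:E)%E].

Section basis_functions.
Context {R : realType} {p : nat}.
Variables (L : nat) (phi : 'I_p -> nat -> R -> R).

(* The index l : 'I_L stands for l.+1 in {1, ..., L}. *)
Definition phi1 (i : 'I_p) (l : 'I_L) (x : p.-tuple R) : R :=
  phi i l.+1 (coord i x).

Definition phi_pair (i j : 'I_p) (a : 'I_(L + L)) : p.-tuple R -> R :=
  match fintype.split a with inl k => phi1 i k | inr k => phi1 j k end.

(* E is a mean: the expectation under the law of X yields the theoretical
   basis functions, the empirical mean their estimators. *)
Variable E : (p.-tuple R -> R) -> R.

Definition gram (i j : 'I_p) : 'M[R]_(L + L) :=
  \matrix_(a, b) E (fun x => phi_pair i j a x * phi_pair i j b x).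

Definition gram_rhs (i j : 'I_p) (li lj : 'I_L) : 'cV[R]_(L + L) :=
  \col_a - E (fun x => phi1 i li x * phi1 j lj x * phi_pair i j a x).

(* For the law of X, <1, phi_k> = 0, so that gram *m lambda = gram_rhs says
   that phi2 below is orthogonal to the 2L functions phi_pair. *)
Definition lambda (i j : 'I_p) (li lj : 'I_L) : 'cV[R]_(L + L) :=
  if gram i j \in unitmx then invmx (gram i j) *m gram_rhs i j li lj else 0.

Definition phi2_uncentered (i j : 'I_p) (li lj : 'I_L) (x : p.-tuple R) : R :=
  phi1 i li x * phi1 j lj x
  + \sum_(k < L) lambda i j li lj (lshift L k) 0 * phi1 i k x
  + \sum_(k < L) lambda i j li lj (rshift L k) 0 * phi1 j k x.

Definition phi2_const (i j : 'I_p) (li lj : 'I_L) : R :=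
  - E (phi2_uncentered i j li lj).

Definition phi2 (i j : 'I_p) (li lj : 'I_L) (x : p.-tuple R) : R :=
  phi2_uncentered i j li lj x + phi2_const i j li lj.

(* Pairs (u, l_u) with 1 <= |u| <= 2. A set u = {i, j} is listed as both (i, j)
   and (j, i); both give the same family of functions, so suprema are
   unaffected. *)
Definition basis_index : Type :=
  (('I_p * 'I_L) + ({ij : 'I_p * 'I_p | ij.1 != ij.2} * ('I_L * 'I_L)))%type.

Definition phi_u (u : basis_index) : p.-tuple R -> R :=
  match u with
  | inl (i, l) => phi1 i l
  | inr (ij, (li, lj)) => phi2 (val ij).1 (val ij).2 li lj
  end.

End basis_functions.

Section estimation.
Context {R : realType} {p : nat}.

Definition mean (PX : probability (p.-tuple R) R) (h : p.-tuple R -> R) : R :=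
  \int[PX]_x h x.

Definition empirical_mean (n1 : nat) (xs : 'I_n1 -> p.-tuple R)
    (h : p.-tuple R -> R) : R :=
  n1%:R^-1 * \sum_(r < n1) h (xs r).

Definition zeta (L : nat) (PX : probability (p.-tuple R) R)
    (phi : 'I_p -> nat -> R -> R) (n1 : nat) (xs : 'I_n1 -> p.-tuple R) :
    \bar R :=
  ereal_sup [set ('N[PX]_2%:E[EFin \o (fun x =>
                   phi_u phi (empirical_mean xs) u x
                   - phi_u phi (mean PX) u x)%R])%E
            | u in [set: basis_index (p := p) L]].

End estimation.

Definition iid_sample {R : realType} {d d'} {Omega : measurableType d}
    {T : measurableType d'} (P : probability Omega R) (Q : probability T R)
    (n1 : nat) (X : 'I_n1 -> {RV P >-> T}) : Prop :=
  (forall r (A : set T), measurable A -> distribution P (X r) A = Q A) /\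
  (forall (J : {set 'I_n1}) (A : 'I_n1 -> set T),
     (forall r, measurable (A r)) ->
     P (\bigcap_(r in [set` J]) (X r @^-1` A r)) =
     (\prod_(r in J) P (X r @^-1` A r))%E).

(* Outer probability: when the Z n are measurable, B can be taken to be the
   event {K |a_n| < |Z_n|} itself. *)
Definition bigO_P {R : realType} {d : nat -> measure_display}
    {Omega : forall n, measurableType (d n)}
    (P : forall n, probability (Omega n) R)
    (Z : forall n, Omega n -> \bar R) (a : nat -> R) : Prop :=
  forall e : R, 0 < e -> exists K : R, forall n, sample_size n ->
    exists B : set (Omega n),
      [/\ measurable B,
          [set w | ((K * `|a n|)%:E < `|Z n w|)%E] `<=` B &
          (P n B <= e%:E)%E].

Section assumptions.
Context {R : realType}.
Variables (L : nat) (p : nat -> nat).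
Variable PX : forall n, probability ((p n).-tuple R) R.
Variable phi : forall n, 'I_(p n) -> nat -> R -> R.

Definition Hb1 : Prop :=
  exists M : R, forall n, sample_size n -> forall (i : 'I_(p n)) (l : 'I_L),
    ('N[PX n]_+oo[EFin \o phi1 (@phi n) i l] <= M%:E)%E.

Definition Hb2 (xi : R) : Prop :=
  exists2 C : R, 0 < C & exists K : R, \forall n \near \oo,
    sample_size n -> (p n)%:R <= K * expR (C * n%:R `^ (1 - xi)).

Definition Hb3 (theta : R) : Prop :=
  exists2 C : R, 0 < C & forall n, sample_size n -> forall i j : 'I_(p n),
    i != j -> C * n%:R `^ (- theta) <= \det (gram L (@phi n) (mean (PX n)) i j).

End assumptions.

(* Main.v *)
(* The problem reduces to finitely many empirical means: by Hoeffding's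
   inequality and a union bound, all empirical means of products of at most
   three basis functions are within t = tau n^(-xi/2) of their expectations, up
   to an event whose probability is small when tau is large.  On that event,
   put A = A^ij and let delta be the error on lambda.  Bounding |delta| costs
   too many powers of |A^-1| = O(n^theta); instead one bounds the quadratic form
   <delta, A delta>, which is exactly the squared L^2 norm of sum_a delta_a
   phi_a.  Since |lambda|^2 <= |A^-1| E[(phi^i phi^j)^2], this form is of order
   (n^theta t)^2.  For the finitely many remaining n one only needs tightness,
   that is, measurability of the estimated coefficients. *)
Require Import Defs.
From HB Require Import structures.
From mathcomp Require Import all_boot all_order all_algebra.
From mathcomp Require Import all_classical all_reals all_analysis.
From mathcomp Require Import measurable_realfun ess_sup_inf.
From mathcomp Require Import ring lra perm.
Set Implicit Arguments.
Unset Strict Implicit.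
Unset Printing Implicit Defensive.
Import Order.TTheory GRing.Theory Num.Theory.
Import numFieldNormedType.Exports.
Import HBNNSimple.
Local Open Scope classical_set_scope.
Local Open Scope ring_scope.

(** * Independence *)

(** Let beta, of order n^theta, satisfy |x|^2 <= beta <x, x>_A for all x. The error solves Ahat
    delta = r with |r|^2 of order beta t^2, because r contains (Ahat - A) lambda. Passing from the
    form to |delta|^2 would cost one more factor beta and end at beta^3 t^2, hence at a rate n^(3
    theta / 2) t; stopping at the form leaves beta^2 t^2. The scale n^(-xi/2) balances the union
    bound: the logarithm of the number of means is of order n^(1 - xi) at most, and so is the
    Hoeffding exponent n t^2, whose factor tau^2 can be made to win. The condition theta < xi/2 says
    that beta t tends to 0. The perturbation Ahat - A then takes away at most half of <x, x>_A,
    which gives the invertibility of Ahat and lets every estimate be made with A. It also keeps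
    |lambdahat|^2 of order beta, as the error on the centring constant requires. *)

(** By linearity the identity passes from indicators to simple functions, and by monotone
    convergence to [g]. In its use, [W] is the product of the other factors and [c] the product of
    their means. *)
Lemma ge0_integral_mul_comp d1 d2 (T1 : measurableType d1)
    (T2 : measurableType d2) (R : realType) (P : {measure set T1 -> \bar R})
    (Q : {measure set T2 -> \bar R}) (W : T1 -> R) (Y : T1 -> T2) (c : R)
    (g : T2 -> R) :
  measurable_fun setT W -> (forall w, 0 <= W w) -> measurable_fun setT Y ->
  0 <= c ->
  (forall A, measurable A ->
     (\int[P]_w (W w * \1_A (Y w))%:E = c%:E * Q A)%E) ->
  measurable_fun setT g -> (forall x, 0 <= g x) ->
  (\int[P]_w (W w * g (Y w))%:E = c%:E * \int[Q]_x (g x)%:E)%E.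
Proof.
move=> mW W0 mY c0 H mg g0.
have mEg : measurable_fun setT (EFin \o g) by exact/measurable_EFinP.
have Eg0 x : [set: T2] x -> (0 <= (EFin \o g) x)%E by rewrite /= lee_fin.
pose g_ := nnsfun_approx measurableT mEg.
have mWg h : measurable_fun setT h ->
    measurable_fun setT (fun w => (W w * h (Y w))%:E).
  move=> mh; apply/measurable_EFinP; apply: measurable_funM => //.
  exact: measurableT_comp mh mY.
have simple n : (\int[P]_w (W w * g_ n (Y w))%:E =
                 c%:E * \int[Q]_x (g_ n x)%:E)%E.
  rewrite -ge0_integralZl_EFin//; last 2 first.
  - by move=> x _; rewrite lee_fin.
  - by apply/measurable_EFinP.
  transitivity (\sum_(k \in range (g_ n))
      \int[P]_w (W w * (k * \1_(g_ n @^-1` [set k]) (Y w)))%:E)%E.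
    rewrite -ge0_integral_fsum//.
    - apply: eq_integral => w _; rewrite fsumEFin// fimfunE; congr (_%:E).
      by rewrite mulr_fsumr.
    - move=> k; apply: (mWg (fun y => k * \1_(g_ n @^-1` [set k]) y)).
      exact: measurable_funM.
    - by move=> k w _; rewrite lee_fin mulr_ge0// -lee_fin EFinM nnfun_muleindic_ge0.
  transitivity (\sum_(k \in range (g_ n))
      \int[Q]_x (c%:E * (k * \1_(g_ n @^-1` [set k]) x)%:E))%E; last first.
    rewrite -ge0_integral_fsum//.
    - apply: eq_integral => x _; rewrite [in RHS]fimfunE -fsumEFin//.
      by rewrite ge0_mule_fsumr// => k; rewrite nnfun_muleindic_ge0.
    - move=> k; apply/measurable_EFinP; apply: measurable_funM => //.
      exact: measurable_funM.
    - by move=> k x _; rewrite mule_ge0// nnfun_muleindic_ge0.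
  apply: eq_fsbigr => k; rewrite inE => -[y _ gy].
  have k0 : 0 <= k by rewrite -gy.
  have mk : measurable (g_ n @^-1` [set k]) by exact: measurable_sfunP.
  rewrite ge0_integralZl_EFin//; last 2 first.
  - by move=> x _; rewrite nnfun_muleindic_ge0.
  - by apply/measurable_EFinP; exact: measurable_funM.
  under [in RHS]eq_integral do rewrite EFinM.
  rewrite ge0_integralZl_EFin//; last exact/measurable_EFinP.
  rewrite integral_indic// setIT muleCA -H//.
  under eq_integral do rewrite mulrCA EFinM.
  rewrite ge0_integralZl_EFin//.
  - by move=> w _; rewrite lee_fin mulr_ge0.
  - exact: mWg.
have cvgg x : ((g_ n x)%:E @[n --> \oo] --> (g x)%:E)%E.
  exact: (cvg_nnsfun_approx measurableT mEg Eg0 (x := x)).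
have ndg x : {homo (fun n => g_ n x) : n m / (n <= m)%N >-> n <= m}.
  by move=> n m nm; exact/lefP/nd_nnsfun_approx.
transitivity (limn (fun n => \int[P]_w (W w * g_ n (Y w))%:E)%E).
  rewrite -monotone_convergence//.
  - apply: eq_integral => w _; apply/esym/cvg_lim => //.
    under eq_fun do rewrite EFinM.
    by rewrite EFinM; apply: cvgeZl.
  - by move=> n; exact: mWg.
  - by move=> n w _; rewrite lee_fin mulr_ge0.
  - by move=> w _ n m nm; rewrite lee_fin ler_wpM2l// ndg.
under eq_fun do rewrite simple.
transitivity (limn (fun n => \int[Q]_x (c%:E * (g_ n x)%:E))%E).
  congr (limn _); apply/funext => n; rewrite ge0_integralZl_EFin//.
  - by move=> x _; rewrite lee_fin.
  - exact/measurable_EFinP.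
rewrite -ge0_integralZl_EFin// -monotone_convergence//.
- by apply: eq_integral => x _; apply/cvg_lim => //; apply: cvgeZl.
- by move=> n; apply/measurable_EFinP; exact: measurable_funM.
- by move=> n x _; rewrite mule_ge0// lee_fin.
- by move=> x _ n m nm; rewrite lee_fin ler_wpM2l// ndg.
Qed.

(* Independence is the formula for indicators, which are then replaced by
   arbitrary functions one factor at a time. *)
Lemma iid_integral_prod d d' (Omega : measurableType d) (T : measurableType d')
    (R : realType) (P : probability Omega R) (Q : probability T R) (n : nat)
    (X : 'I_n -> {RV P >-> T}) (h : 'I_n -> T -> R) :
  iid_sample Q X -> (forall r, measurable_fun setT (h r)) ->
  (forall r x, 0 <= h r x) -> (forall r, (\int[Q]_x (h r x)%:E < +oo)%E) ->
  (\int[P]_w (\prod_r h r (X r w))%:E = \prod_r \int[Q]_x (h r x)%:E)%E.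
Proof.
move=> [lawX indX].
(* Induction on the number [k] of factors allowed to be arbitrary: those of index at least [k] are
   still indicators, a void condition at [k = n]. *)
suff main k : forall h : 'I_n -> T -> R, (forall r, measurable_fun setT (h r)) ->
  (forall r x, 0 <= h r x) -> (forall r, (\int[Q]_x (h r x)%:E < +oo)%E) ->
  (forall r : 'I_n, (k <= r)%N -> exists2 A, measurable A & h r = \1_A) ->
  (\int[P]_w (\prod_r h r (X r w))%:E = \prod_r \int[Q]_x (h r x)%:E)%E.
  move=> mh h0 hfin; apply: (main n) => // r.
  by rewrite leqNgt ltn_ord.
elim: k => [|k IH] {}h mh h0 hfin hind.
  have /choice[A hA] : forall r : 'I_n, exists A, measurable A /\ h r = \1_A.
    by move=> r; have [A mA hA] := hind r isT; exists A.
  have mA r : measurable (A r) := (hA r).1.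
  have mXA r : measurable (X r @^-1` A r).
    by rewrite -[X in measurable X]setTI; exact: measurable_funP.
  transitivity (P (\bigcap_(r in [set` [set: 'I_n]%SET]) (X r @^-1` A r))).
    rewrite -[X in _ = P X]setIT -integral_indic//; last first.
      exact: (fin_bigcap_measurable finite_finset (fun r _ => mXA r)).
    apply: eq_integral => w _; congr (_%:E).
    have [wA|/existsNP[r wAr]] := pselect (forall r, A r (X r w)).
      rewrite indicE mem_set; last by move=> r _; exact: wA.
      by apply: big1 => r _; rewrite (hA r).2 indicE mem_set//; exact: wA.
    rewrite indicE memNset; last first.
      by move=> /(_ r); apply/not_implyP; split=> //=; rewrite inE.
    by rewrite (bigD1 r)//= (hA r).2 indicE memNset// mul0r.
  rewrite indX//; apply: eq_big => [r|r _]; first by rewrite inE.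
  by rewrite (hA r).2 integral_indic// setIT; exact: lawX.
have [kn|nk] := ltnP k n; last first.
  by apply: IH => // r kr; have := leq_trans nk kr; rewrite leqNgt ltn_ord.
pose r0 := Ordinal kn.
have hfnum r : (\int[Q]_x (h r x)%:E)%E \is a fin_num.
  by rewrite ge0_fin_numE// integral_ge0// => x _; rewrite lee_fin.
(* Finiteness of the means makes this product a real number, as the constant [c] of
   [ge0_integral_mul_comp] must be. *)
have prodE : (\prod_(r | r != r0) \int[Q]_x (h r x)%:E =
    (\prod_(r | r != r0) fine (\int[Q]_x (h r x)%:E))%:E)%E.
  by rewrite -prodEFin; apply: eq_bigr => r _; rewrite fineK.
rewrite [RHS](bigD1 r0)//= prodE muleC.
under eq_integral do rewrite (bigD1 r0)//= mulrC.
apply: (ge0_integral_mul_comp (Y := X r0)) => //.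
- under eq_fun do rewrite -big_filter; apply: measurable_prod => r _.
  exact: measurableT_comp (mh r) (measurable_funP (X r)).
- by move=> w; apply: prodr_ge0.
- apply: prodr_ge0 => r _; apply: fine_ge0; apply: integral_ge0 => x _.
  by rewrite lee_fin.
move=> A mA.
(* With the factor [r0] turned back into an indicator, the induction hypothesis applies and gives
   the identity to be extended. *)
pose h' r := if r == r0 then \1_A else h r.
have h'E r : r != r0 -> h' r = h r by rewrite /h' => /negbTE ->.
have h'0 : h' r0 = \1_A by rewrite /h' eqxx.
have int1 : (\int[Q]_x (\1_A x)%:E = Q A)%E by rewrite integral_indic// setIT.
have c_h' : (\prod_(r | r != r0) \int[Q]_x (h' r x)%:E)%E =
    (\prod_(r | r != r0) fine (\int[Q]_x (h r x)%:E))%:E.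
  by rewrite -prodE; apply: eq_bigr => r rr0; rewrite h'E.
transitivity (\int[P]_w (\prod_r h' r (X r w))%:E)%E.
  apply: eq_integral => w _; congr (_%:E).
  rewrite [RHS](bigD1 r0)//= h'0 mulrC; congr (_ * _).
  by apply: eq_bigr => r rr0; rewrite h'E.
rewrite IH.
- by rewrite (bigD1 r0)//= h'0 int1 c_h' muleC.
- by move=> r; rewrite /h'; case: ifP.
- by move=> r x; rewrite /h'; case: ifP.
- move=> r; rewrite /h'; case: ifP => // _; rewrite int1.
  by rewrite (le_lt_trans (probability_le1 _ _)) ?ltry.
- move=> r kr; rewrite /h'; case: eqVneq => [_|rr0]; first by exists A.
  by apply: hind; rewrite ltn_neqAle kr andbT eq_sym.
Qed.

(** * Essentially bounded functions and Hoeffding's inequality *)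

(** The bound holds only almost everywhere because the boundedness assumption concerns an essential
    supremum. Explicit bounds propagate through sums and products and provide all the integrability
    needed. *)
Definition ae_bounded d (T : measurableType d) (R : realType)
    (Q : probability T R) (B : R) (f : T -> R) : Prop :=
  measurable_fun setT f /\ {ae Q, forall x, `|f x| <= B}.

Section ae_bounded_theory.
Context d (T : measurableType d) (R : realType) (Q : probability T R).
Implicit Types (f g : T -> R) (B : R).

Lemma ae_bounded_ge0 B f : ae_bounded Q B f -> 0 <= B.
Proof.
move=> [_ fB]; rewrite leNgt; apply/negP => B0.
have : {ae Q, forall x : T, False}.
  apply: filterS fB => x fxB; have := le_lt_trans (le_trans (normr_ge0 _) fxB) B0.
  by rewrite ltxx.
move=> [N [mN N0 sN]]; have : (Q setT <= Q N)%E.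
  by apply: le_measure; rewrite ?inE// => x _; exact: sN.
by rewrite N0 probability_setT leNgt lte_fin ltr01.
Qed.

Lemma ae_bounded_cst B c : `|c| <= B -> ae_bounded Q B (fun=> c).
Proof. by move=> cB; split => //; apply: aeW. Qed.

Lemma ae_boundedN B f : ae_bounded Q B f -> ae_bounded Q B (fun x => - f x).
Proof.
move=> [mf fB]; split; first exact: measurableT_comp.
by apply: filterS fB => x; rewrite normrN.
Qed.

Lemma ae_boundedD B B' f g : ae_bounded Q B f -> ae_bounded Q B' g ->
  ae_bounded Q (B + B') (fun x => f x + g x).
Proof.
move=> [mf fB] [mg gB]; split; first exact: measurable_funD.
by apply: filterS2 fB gB => x fB gB; rewrite (le_trans (ler_normD _ _))// lerD.
Qed.

Lemma ae_boundedM B B' f g : ae_bounded Q B f -> ae_bounded Q B' g ->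
  ae_bounded Q (B * B') (fun x => f x * g x).
Proof.
move=> [mf fB] [mg gB]; split; first exact: measurable_funM.
by apply: filterS2 fB gB => x fB gB; rewrite normrM ler_pM.
Qed.

Lemma ae_bounded_sum (I : Type) (s : seq I) (B : I -> R) (f : I -> T -> R) :
  (forall i, ae_bounded Q (B i) (f i)) ->
  ae_bounded Q (\sum_(i <- s) B i) (fun x => \sum_(i <- s) f i x).
Proof.
move=> fB; elim: s => [|i s IH].
  under [X in ae_bounded _ _ X]eq_fun do rewrite big_nil.
  by rewrite big_nil; apply: ae_bounded_cst; rewrite normr0.
under [X in ae_bounded _ _ X]eq_fun do rewrite big_cons.
by rewrite big_cons; exact: ae_boundedD.
Qed.

Let QT : (Q : {measure set T -> \bar R}) setT = 1%E.
Proof. exact: probability_setT. Qed.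

Let aeT B f : {ae Q, forall x, `|f x| <= B} ->
  {ae Q, forall x, [set: T] x -> (`|(EFin \o f) x| <= B%:E)%E}.
Proof. by apply: filterS => x fB _; rewrite /= lee_fin. Qed.

Lemma ae_bounded_integrable B f :
  ae_bounded Q B f -> Q.-integrable setT (EFin \o f).
Proof.
move=> /[dup] /ae_bounded_ge0 B0 [mf fB]; have mEf : measurable_fun setT (EFin \o f) by exact/measurable_EFinP.
apply/integrableP; split => //.
apply: le_lt_trans (integral_le_bound B%:E measurableT mEf _ (aeT fB)) _ => //.
by rewrite QT mule1 ltry.
Qed.

Lemma ae_bounded_integralE B f : ae_bounded Q B f ->
  (\int[Q]_x (f x)%:E = (\int[Q]_x f x)%:E)%E.
Proof.
move=> /ae_bounded_integrable fi; rewrite /Rintegral fineK//.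
exact: integrable_fin_num.
Qed.

Lemma Rintegral_prob_cst (c : R) : \int[Q]_x c = c.
Proof. by rewrite Rintegral_cst// QT mulr1. Qed.

Lemma ae_bounded_RintegralD B B' f g : ae_bounded Q B f -> ae_bounded Q B' g ->
  \int[Q]_x (f x + g x) = \int[Q]_x f x + \int[Q]_x g x.
Proof.
by move=> fB gB; rewrite RintegralD//; apply: ae_bounded_integrable; eassumption.
Qed.

Lemma ae_bounded_RintegralZl B f c : ae_bounded Q B f ->
  \int[Q]_x (c * f x) = c * \int[Q]_x f x.
Proof. by move=> fB; rewrite RintegralZl//; exact: ae_bounded_integrable fB. Qed.

Lemma ae_bounded_Rintegral_sum (I : Type) (s : seq I) (B : I -> R)
    (f : I -> T -> R) : (forall i, ae_bounded Q (B i) (f i)) ->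
  \int[Q]_x (\sum_(i <- s) f i x) = \sum_(i <- s) \int[Q]_x f i x.
Proof.
move=> fB; elim: s => [|i s IH].
  by under [in LHS]eq_fun do rewrite big_nil; rewrite big_nil Rintegral_prob_cst.
under [in LHS]eq_fun do rewrite big_cons.
rewrite big_cons -IH (ae_bounded_RintegralD (fB i) (ae_bounded_sum s fB))//.
Qed.

Lemma ae_bounded_Rintegral_le B f : ae_bounded Q B f -> `|\int[Q]_x f x| <= B.
Proof.
move=> fB; have [mf afB] := fB.
rewrite -lee_fin (EFin_normr_Rintegral measurableT (ae_bounded_integrable fB)).
have mEf : measurable_fun setT (EFin \o f) by exact/measurable_EFinP.
rewrite (le_trans (le_abse_integral Q measurableT mEf))//.
apply: le_trans (integral_le_bound B%:E measurableT mEf _ (aeT afB)) _ => //.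
  exact: ae_bounded_ge0 fB.
by rewrite QT mule1.
Qed.

End ae_bounded_theory.

(** Inverting 1 - x <= exp(-x) gives exp(x) <= 1 / (1 - x), and (1 - x)(1 + x + 2 x^2) = 1 + x^2 (1
    - 2 x) >= 1. *)
Lemma expR_le_quadratic (R : realType) (x : R) :
  x <= 2^-1 -> expR x <= 1 + x + 2 * x ^+ 2.
Proof.
move=> x2.
have e0 := expR_gt0 x.
have h : (1 - x) * expR x <= 1.
  have := expR_ge1Dx (- x); rewrite expRN => h.
  by rewrite -[leRHS](@mulVf _ (expR x)) ?gt_eqF// ler_wpM2r// ltW.
have x1 : 0 < 1 - x by lra.
rewrite -(ler_pM2l x1) (le_trans h)//.
have : 0 <= x ^+ 2 * (1 - 2 * x) by apply: mulr_ge0; [exact: sqr_ge0|lra].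
lra.
Qed.

(** The linear term has mean 0, so the quadratic bound integrates to at most 1 + 2 (s B)^2. The
    constant is weaker than in Hoeffding's lemma and [s] is restricted, which is harmless for small
    deviations. *)
Lemma mgf_bound d (T : measurableType d) (R : realType) (Q : probability T R)
    (B s : R) (f : T -> R) :
  ae_bounded Q B f -> \int[Q]_x f x = 0 -> 0 <= s -> s * B <= 2^-1 ->
  (\int[Q]_x (expR (s * f x))%:E <= (expR (2 * (s * B) ^+ 2))%:E)%E.
Proof.
move=> fB f0 s0 sB; have [mf afB] := fB.
have sfB := ae_boundedM (ae_bounded_cst Q (lexx `|s|)) fB.
have qB := ae_boundedM (ae_bounded_cst Q (lexx `|2 * s ^+ 2|)) (ae_boundedM fB fB).
have hB := ae_boundedD (ae_boundedD (ae_bounded_cst Q (lexx `|1|)) sfB) qB.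
apply: (@le_trans _ _ (\int[Q]_x (1 + s * f x + 2 * s ^+ 2 * (f x * f x))%:E)%E).
  apply: ae_ge0_le_integral => //.
  - apply/measurable_EFinP; apply: measurableT_comp => //.
    exact: sfB.1.
  - move=> x _; rewrite lee_fin.
    have := sqr_ge0 (1 + 2 * (s * f x)); have := sqr_ge0 (s * f x); lra.
  - by apply/measurable_EFinP; exact: hB.1.
  - apply: filterS afB => x fxB _; rewrite lee_fin.
    apply: le_trans (expR_le_quadratic _) _.
      by apply: le_trans sB; rewrite ler_wpM2l// (le_trans (ler_norm _)).
    lra.
rewrite (ae_bounded_integralE hB) lee_fin.
rewrite (ae_bounded_RintegralD (ae_boundedD (ae_bounded_cst Q (lexx `|1|)) sfB) qB).
rewrite (ae_bounded_RintegralD (ae_bounded_cst Q (lexx `|1|)) sfB).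
rewrite Rintegral_prob_cst (ae_bounded_RintegralZl _ fB) f0.
rewrite (ae_bounded_RintegralZl _ (ae_boundedM fB fB)).
apply: le_trans (expR_ge1Dx _); rewrite mulr0 addr0 lerD2l.
have -> : 2 * (s * B) ^+ 2 = 2 * s ^+ 2 * (B * B) by ring.
apply: ler_wpM2l; first by rewrite mulr_ge0// sqr_ge0.
exact: le_trans (ler_norm _) (ae_bounded_Rintegral_le (ae_boundedM fB fB)).
Qed.

Lemma hoeffding_one_sided d d' (Omega : measurableType d)
    (T : measurableType d') (R : realType) (P : probability Omega R)
    (Q : probability T R) (n : nat) (X : 'I_n -> {RV P >-> T}) (f : T -> R)
    (B t : R) :
  iid_sample Q X -> ae_bounded Q B f -> \int[Q]_x f x = 0 -> 0 < t ->
  t <= 2 * B ->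
  (P [set w | (n%:R * t <= \sum_r f (X r w))%R] <=
   (expR (- (n%:R * t ^+ 2 / (8 * B ^+ 2))))%:E)%E.
Proof.
move=> iidX fB f0 t0 tB; have [mf _] := fB.
have B0 : 0 < B by lra.
pose Y w := \sum_r f (X r w).
have mY : measurable_fun setT Y.
  by apply: measurable_sum => r; exact: measurableT_comp mf (measurable_funP (X r)).
pose Ymix := isMeasurableFun.Build _ _ _ _ Y mY.
pose Yrv : {RV P >-> R} := HB.pack Y Ymix.
(* The minimiser of - s n t + 2 n (s B)^2; the condition s B <= 1/2 is then [t <= 2 * B]. *)
pose s := t / (4 * B ^+ 2).
have s0 : 0 < s by rewrite divr_gt0// mulr_gt0// exprn_gt0.
have sBE : s * B = t / (4 * B) by rewrite /s; field; rewrite gt_eqF.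
have sB : s * B <= 2^-1 by rewrite sBE ler_pdivrMr ?mulr_gt0//; lra.
apply: le_trans (chernoff Yrv (n%:R * t) s0) _.
have -> : ('M_P Yrv s = \prod_(r < n) \int[Q]_x (expR (s * f x))%:E)%E.
  rewrite /mmt_gen_fun unlock /=.
  rewrite -(iid_integral_prod iidX (h := fun _ x => expR (s * f x)))//.
  - by apply: eq_integral => w _; rewrite /= /Y mulrC mulr_sumr expR_sum.
  - by move=> r; apply: measurableT_comp => //; exact: measurable_funM.
  - move=> r; apply: le_lt_trans (mgf_bound fB f0 (ltW s0) sB) _.
    exact: ltry.
have hprod : (\prod_(r < n) \int[Q]_x (expR (s * f x))%:E <=
    (expR (n%:R * (2 * (s * B) ^+ 2)))%:E)%E.
  have mgf := mgf_bound fB f0 (ltW s0) sB.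
  have i0 : (0 <= \int[Q]_x (expR (s * f x))%:E)%E.
    by apply: integral_ge0 => x _; rewrite lee_fin expR_ge0.
  elim: (n) => [|m IH]; first by rewrite big_ord0 mul0r expR0.
  rewrite big_ord_recr/= -natr1 mulrDl mul1r expRD EFinM lee_pmul//.
  exact: prode_ge0.
apply: (le_trans (lee_pmul _ _ hprod (lexx _))).
- by apply: prode_ge0 => r _; apply: integral_ge0 => x _; rewrite lee_fin expR_ge0.
- by rewrite lee_fin expR_ge0.
rewrite -EFinM lee_fin -expRD ler_expR; rewrite le_eqVlt.
apply/orP; left; apply/eqP; rewrite sBE /s; field.
by rewrite gt_eqF.
Qed.

(** Centring [f] can double its bound, which turns 8 into 32 and the range 2 B into 4 B; the factor
    2 comes from treating [f] and its opposite. *)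
Lemma hoeffding d d' (Omega : measurableType d)
    (T : measurableType d') (R : realType) (P : probability Omega R)
    (Q : probability T R) (n : nat) (X : 'I_n -> {RV P >-> T}) (f : T -> R)
    (B t : R) :
  iid_sample Q X -> ae_bounded Q B f -> 0 < t -> t <= 4 * B ->
  (P [set w | (n%:R * t <= `|\sum_r (f (X r w) - \int[Q]_x f x)|)%R] <=
   (2 * expR (- (n%:R * t ^+ 2 / (32 * B ^+ 2))))%:E)%E.
Proof.
move=> iidX fB t0 tB; set m := \int[Q]_x f x.
have cB c : `|c| <= B -> ae_bounded Q B (fun=> c) by exact: ae_bounded_cst.
have mB : `|m| <= B := ae_bounded_Rintegral_le fB.
have gB := ae_boundedD fB (cB (- m) _); rewrite normrN in gB; have {}gB := gB mB.
have g0 : \int[Q]_x (f x - m) = 0.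
  rewrite (ae_bounded_RintegralD fB (cB (- m) _)) ?normrN//.
  by rewrite Rintegral_prob_cst subrr.
have NgB := ae_boundedN gB.
have Ng0 : \int[Q]_x - (f x - m) = 0.
  under eq_Rintegral do rewrite -mulN1r.
  by rewrite (ae_bounded_RintegralZl _ gB) g0 mulr0.
have t2 : t <= 2 * (B + B) by lra.
have msum (g : T -> R) : measurable_fun setT g ->
    measurable [set w | n%:R * t <= \sum_r g (X r w)].
  move=> mg; rewrite -[X in measurable X]setTI.
  apply: measurable_fun_le => //.
  apply: measurable_sum => r; exact: measurableT_comp mg (measurable_funP (X r)).
have exE : 8 * (B + B) ^+ 2 = 32 * B ^+ 2 by ring.
have h1 := hoeffding_one_sided iidX gB g0 t0 t2.
have h2 := hoeffding_one_sided iidX NgB Ng0 t0 t2.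
rewrite exE in h1 h2.
apply: (@le_trans _ _ (P ([set w | n%:R * t <= \sum_r (f (X r w) - m)] `|`
   [set w | n%:R * t <= \sum_r - (f (X r w) - m)]))).
  apply: le_measure; rewrite ?inE.
  - rewrite -[X in measurable X]setTI; apply: measurable_fun_le => //.
    apply: measurableT_comp => //; apply: measurable_sum => r.
    exact: measurableT_comp gB.1 (measurable_funP (X r)).
  - by apply: measurableU; [exact: msum gB.1|exact: msum NgB.1].
  - by move=> w /=; rewrite sumrN ler_normr => /orP[]; [left|right].
apply: le_trans (measureU2 _ _ _) _; [exact: msum gB.1|exact: msum NgB.1|].
by rewrite mulr2n mulrDl mul1r EFinD leeD.
Qed.

(** * Perturbation of linear systems *)

Section quadratic_forms.
Context {R : realFieldType} {m : nat}.
Implicit Types (A B : 'M[R]_m) (x y : 'cV[R]_m).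

Definition bilin A x y : R := (x^T *m A *m y) 0 0.
Definition sqnorm x : R := \sum_a x a 0 ^+ 2.

Lemma bilinE A x y : bilin A x y = \sum_a \sum_b x a 0 * A a b * y b 0.
Proof.
rewrite /bilin mxE exchange_big/=; apply: eq_bigr => b _.
by rewrite !mxE mulr_suml; apply: eq_bigr => a _; rewrite mxE.
Qed.

Lemma bilinDl A x x' y : bilin A (x + x') y = bilin A x y + bilin A x' y.
Proof. by rewrite /bilin linearD/= !mulmxDl mxE. Qed.

Lemma bilinDr A x y y' : bilin A x (y + y') = bilin A x y + bilin A x y'.
Proof. by rewrite /bilin mulmxDr mxE. Qed.

Lemma bilinZl A s x y : bilin A (s *: x) y = s * bilin A x y.
Proof. by rewrite /bilin linearZ/= -!scalemxAl mxE. Qed.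

Lemma bilinZr A s x y : bilin A x (s *: y) = s * bilin A x y.
Proof. by rewrite /bilin -!scalemxAr mxE. Qed.

Lemma bilinC A x y : A^T = A -> bilin A x y = bilin A y x.
Proof.
move=> symA; transitivity ((x^T *m A *m y)^T 0 0); first by rewrite mxE.
by rewrite !trmx_mul trmxK symA mulmxA.
Qed.

Lemma bilin1 x : bilin 1%:M x x = sqnorm x.
Proof. by rewrite /bilin mulmx1 mxE; apply: eq_bigr => a _; rewrite mxE expr2. Qed.

Lemma bilin_mulr A B x y : bilin A x (B *m y) = bilin (A *m B) x y.
Proof. by rewrite /bilin !mulmxA. Qed.

Lemma sqnorm_ge0 x : 0 <= sqnorm x.
Proof. by apply: sumr_ge0 => a _; exact: sqr_ge0. Qed.

Lemma sqnormD x y : sqnorm (x + y) <= 2 * sqnorm x + 2 * sqnorm y.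
Proof.
rewrite /sqnorm !mulr_sumr -big_split/=; apply: ler_sum => a _; rewrite mxE.
have := sqr_ge0 (x a 0 - y a 0); lra.
Qed.

Lemma dot_le x y s :
  2 * s * bilin 1%:M x y <= sqnorm x + s ^+ 2 * sqnorm y.
Proof.
have := sqnorm_ge0 (x - s *: y); rewrite -bilin1 -scaleN1r.
rewrite !(bilinDl, bilinDr, bilinZl, bilinZr) !bilin1.
rewrite (bilinC y x (trmx1 _ _)); lra.
Qed.

Lemma sqr_sum_le (z : 'I_m -> R) : (\sum_a z a) ^+ 2 <= m%:R * \sum_a z a ^+ 2.
Proof.
have -> : m%:R * \sum_a z a ^+ 2 =
    \sum_a \sum_b (2^-1 * z a ^+ 2 + 2^-1 * z b ^+ 2).
  under [in RHS]eq_bigr do rewrite big_split/= sumr_const card_ord -mulr_sumr.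
  rewrite big_split/= sumr_const card_ord sumrMnl -mulr_sumr -mulrnDl.
  have half : 2^-1 + 2^-1 = 1 :> R by field.
  by rewrite -mulrDl half mul1r mulr_natl.
rewrite expr2 mulr_suml; apply: ler_sum => a _; rewrite mulr_sumr.
apply: ler_sum => b _; have := sqr_ge0 (z a - z b); lra.
Qed.

Lemma bilin_bound B (e : R) x : (forall a b, `|B a b| <= e) ->
  `|bilin B x x| <= e * m%:R * sqnorm x.
Proof.
move=> Be; rewrite bilinE.
apply: le_trans (ler_norm_sum _ _ _) _.
apply: (@le_trans _ _ (\sum_a \sum_b e * (`|x a 0| * `|x b 0|))).
  apply: ler_sum => a _; apply: le_trans (ler_norm_sum _ _ _) _.
  apply: ler_sum => b _; rewrite !normrM mulrAC mulrC.
  by apply: ler_wpM2r => //; exact: mulr_ge0.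
(* In dimension 0 nothing forces [e] to be nonnegative, but both sides vanish. *)
case: (pselect (exists a : 'I_m, True)) => [[a0 _]|nI]; last first.
  rewrite big1 ?big1 => // [|a]; last by case: nI; exists a.
  by rewrite /sqnorm big1 ?mulr0// => a; case: nI; exists a.
have e0 : 0 <= e := le_trans (normr_ge0 _) (Be a0 a0).
have -> : \sum_a \sum_b e * (`|x a 0| * `|x b 0|) = e * (\sum_a `|x a 0|) ^+ 2.
  rewrite expr2 mulr_suml mulr_sumr; apply: eq_bigr => a _.
  by rewrite mulr_sumr mulr_sumr.
rewrite -mulrA; apply: ler_wpM2l => //; apply: le_trans (sqr_sum_le _) _.
by under eq_bigr do rewrite -normrX ger0_norm ?sqr_ge0//.
Qed.

(* With u = A^-1 x one has <u, x>_A = |x|^2 and <u, u>_A <= m b |x|^2; expand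
   0 <= <s u - x, s u - x>_A at s = 1 / (m b). *)
Lemma coercive_invmx A (b : R) : A^T = A -> A \in unitmx ->
  (forall x, 0 <= bilin A x x) -> 0 < m%:R * b ->
  (forall i j, `|invmx A i j| <= b) ->
  forall x, sqnorm x <= m%:R * b * bilin A x x.
Proof.
move=> symA uA psd mb0 invb x; set beta := m%:R * b in mb0 *.
pose u := invmx A *m x; pose s := beta^-1.
have ux : bilin A u x = sqnorm x.
  by rewrite bilinC// bilin_mulr mulmxV// bilin1.
have uu : bilin A u u <= beta * sqnorm x.
  rewrite bilin_mulr mulmxV// /bilin mulmx1 trmx_mul trmx_inv symA.
  rewrite -/(bilin (invmx A) x x) (le_trans (ler_norm _))//.
  by rewrite /beta [m%:R * b]mulrC bilin_bound.
have := psd (s *: u - x).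
rewrite -scaleN1r !(bilinDl, bilinDr, bilinZl, bilinZr) (bilinC x u symA) ux => h.
have suu : s * (s * bilin A u u) <= s * sqnorm x.
  apply: ler_wpM2l; first by rewrite invr_ge0 ltW.
  by rewrite /s ler_pdivrMl.
rewrite -ler_pdivrMl// -/s; lra.
Qed.

End quadratic_forms.

(** * Inverse matrices from a lower bound on the determinant *)

Section determinant_bounds.
Context {R : realFieldType}.

Lemma det_bound (k : nat) (A : 'M[R]_k) (G : R) :
  (forall i j, `|A i j| <= G) -> `|\det A| <= k`!%:R * G ^+ k.
Proof.
move=> AG; apply: le_trans (ler_norm_sum _ _ _) _.
apply: (@le_trans _ _ (\sum_(s : 'S_k) G ^+ k)); last first.
  by rewrite sumr_const card_Sn mulr_natl.
apply: ler_sum => s _; rewrite normrM normrX normrN1 expr1n mul1r normr_prod.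
rewrite -[X in G ^+ X]card_ord -prodr_const.
by apply: ler_prod => i _; rewrite normr_ge0 AG.
Qed.

(** Cramer's rule: the entries of the adjugate are, up to sign, minors of order [m.-1], bounded
    through the Leibniz formula. *)
Lemma invmx_bound (m : nat) (A : 'M[R]_m) (G c : R) :
  (forall i j, `|A i j| <= G) -> 0 < c -> c <= \det A ->
  forall i j, `|invmx A i j| <= c^-1 * (m.-1`!%:R * G ^+ m.-1).
Proof.
move=> AG c0 cdet i j.
have d0 : 0 < \det A by exact: lt_le_trans cdet.
have uA : A \in unitmx by rewrite unitmxE unitfE gt_eqF.
rewrite /invmx uA mxE normrM normfV (gtr0_norm d0).
apply: ler_pM => //.
- by rewrite invr_ge0 ltW.
- by rewrite lef_pV2.
rewrite mxE /cofactor normrM normrX normrN1 expr1n mul1r det_bound// => a b.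
by rewrite !mxE.
Qed.

End determinant_bounds.

(* delta = lhat - l solves Ahat delta = r with r = (Dhat - D) - (Ahat - A) l.
   Estimating <delta, delta>_A rather than |delta| costs a single factor beta
   in the squared norm, since |r|^2 is itself of order beta t^2. *)
Lemma perturbed_solution (R : realFieldType) (m : nat) (A Ah : 'M[R]_m)
    (l D Dh : 'cV[R]_m) (beta t e0 : R) :
  (forall x, sqnorm x <= beta * bilin A x x) -> 1 <= beta ->
  A *m l = D -> bilin A l l <= e0 ->
  (forall a b, `|(Ah - A) a b| <= t) -> (forall a, `|(Dh - D) a 0| <= t) ->
  0 <= t -> t * m%:R * beta <= 2^-1 ->
  [/\ Ah \in unitmx,
      bilin A (invmx Ah *m Dh - l) (invmx Ah *m Dh - l) <=
        8 * m%:R * (1 + m%:R * e0) * (beta * t) ^+ 2 &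
      sqnorm (invmx Ah *m Dh) <= (2 * e0 + 4 * (1 + m%:R * e0)) * beta].
Proof.
move=> coer b1 Al le0 Adiff Ddiff t0 small.
have b0 : 0 < beta by exact: lt_le_trans b1.
have m0 : 0 <= m%:R :> R by [].
have q0 x : 0 <= bilin A x x.
  by rewrite -(pmulr_rge0 _ b0) (le_trans (sqnorm_ge0 x)).
have e00 : 0 <= e0 := le_trans (q0 l) le0.
have hatE x y : bilin Ah x y = bilin A x y + bilin (Ah - A) x y.
  by rewrite -{1}(subrK A Ah) /bilin mulmxDr mulmxDl mxE addrC.
(* By coercivity, smallness of [t] makes the perturbation at most half of the form of [A]. *)
have half x : bilin A x x <= 2 * bilin Ah x x.
  rewrite hatE.
  have := bilin_bound x Adiff; rewrite ler_norml => /andP[h _].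
  have h2 : t * m%:R * sqnorm x <= 2^-1 * bilin A x x.
    apply: (@le_trans _ _ (t * m%:R * (beta * bilin A x x))).
      by apply: ler_wpM2l; [exact: mulr_ge0|exact: coer].
    by rewrite mulrA; apply: ler_wpM2r.
  lra.
(* A vector killed by [Ah] has zero form for [Ah], hence for [A] by [half], hence is zero by
   coercivity. *)
have uAh : Ah \in unitmx.
  rewrite unitmxE unitfE; apply/det0P => -[v v0 vA]; move/eqP: v0; apply.
  have bv : bilin Ah v^T v^T = 0 by rewrite /bilin trmxK vA mul0mx mxE.
  have : sqnorm v^T <= 0.
    rewrite (le_trans (coer _))// pmulr_rle0//.
    by rewrite (le_trans (half _))// bv mulr0.
  move=> sv; have /eqP : sqnorm v^T == 0 by rewrite eq_le sv sqnorm_ge0.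
  move/psumr_eq0P => h; apply/rowP => a; rewrite [RHS]mxE; apply/eqP.
  by have := h (fun a _ => sqr_ge0 _) a isT; rewrite mxE => /eqP; rewrite sqrf_eq0.
set lh := invmx Ah *m Dh; pose delta := lh - l.
pose r := (Dh - D) - (Ah - A) *m l.
have Adelta : Ah *m delta = r.
  rewrite /delta mulmxBr /lh mulKVmx// /r mulmxBl Al.
  by rewrite opprB addrA subrK.
have l2 : sqnorm l <= beta * e0.
  by rewrite (le_trans (coer l))// ler_pM2l.
have r2 : sqnorm r <= 2 * m%:R * t ^+ 2 * (1 + m%:R * (beta * e0)).
  have h1 : sqnorm (Dh - D) <= m%:R * t ^+ 2.
    rewrite mulr_natl -[X in _ *+ X]card_ord -sumr_const; apply: ler_sum => a _.
    by rewrite -[leLHS]ger0_norm ?sqr_ge0// normrX lerXn2r// nnegrE.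
  have h2 : sqnorm (- ((Ah - A) *m l)) <= m%:R * (t ^+ 2 * (m%:R * (beta * e0))).
    rewrite mulr_natl -[X in _ *+ X]card_ord -sumr_const; apply: ler_sum => a _.
    rewrite mxE sqrrN mxE.
    apply: le_trans (sqr_sum_le _) _; rewrite mulrCA; apply: ler_wpM2l => //.
    apply: (@le_trans _ _ (t ^+ 2 * sqnorm l)); last first.
      by apply: ler_wpM2l => //; exact: sqr_ge0.
    rewrite /sqnorm mulr_sumr; apply: ler_sum => b _; rewrite exprMn.
    apply: ler_wpM2r; first exact: sqr_ge0.
    by rewrite -[leLHS]ger0_norm ?sqr_ge0// normrX lerXn2r// nnegrE.
  have := sqnormD (Dh - D) (- ((Ah - A) *m l)); rewrite -/r; lra.
(* The form of [Ah] at delta is the inner product of delta and [r]. The weight 2 beta in [dot_le] is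
   chosen so that the resulting |delta|^2 <= beta <delta, delta>_A is absorbed on the left. *)
have q2 : bilin A delta delta <= 4 * beta * sqnorm r.
  have dr : bilin Ah delta delta = bilin 1%:M delta r.
    by rewrite -Adelta bilin_mulr mul1mx.
  have := dot_le delta r (2 * beta); rewrite -dr => sq.
  have hd := half delta; have cd := coer delta.
  have : beta * (4 * bilin Ah delta delta) <=
      beta * (bilin A delta delta + 4 * beta * sqnorm r) by lra.
  rewrite ler_pM2l//; lra.
have b2 : beta * t ^+ 2 <= (beta * t) ^+ 2.
  by rewrite exprMn; apply: ler_wpM2r; [exact: sqr_ge0|exact: ler_eXnr].
have q3 : bilin A delta delta <= 8 * m%:R * (1 + m%:R * e0) * (beta * t) ^+ 2.
  apply: (le_trans q2).
  apply: (@le_trans _ _ (4 * beta * (2 * m%:R * t ^+ 2 * (1 + m%:R * (beta * e0))))).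
    by apply: ler_wpM2l r2; rewrite mulr_ge0// ltW.
  have -> : 4 * beta * (2 * m%:R * t ^+ 2 * (1 + m%:R * (beta * e0))) =
    8 * m%:R * (beta * t ^+ 2 + m%:R * e0 * (beta * t) ^+ 2) by ring.
  rewrite -[leRHS]mulrA; apply: ler_wpM2l; [exact: mulr_ge0|by rewrite mulrDl mul1r lerD2r].
split=> //.
have -> : lh = l + delta by rewrite /delta addrC subrK.
apply: (le_trans (sqnormD _ _)).
have cd := coer delta.
(* The square of the smallness condition, up to one factor [m]. It bounds the form of delta by a
   constant, so that the estimated solution has squared norm of order beta, like [l]. *)
have mb : m%:R * (beta * t) ^+ 2 <= 4^-1.
  apply: (@le_trans _ _ ((t * m%:R * beta) ^+ 2)).
    have -> : (t * m%:R * beta) ^+ 2 = m%:R ^+ 2 * (beta * t) ^+ 2 by ring.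
    apply: ler_wpM2r; first exact: sqr_ge0.
    by case: (m) => [|k]; rewrite ?expr0n// ler_eXnr// ler1n.
  have -> : 4^-1 = 2^-1 ^+ 2 :> R by field.
  by rewrite lerXn2r// nnegrE ?invr_ge0// !mulr_ge0// ltW.
have q4 : bilin A delta delta <= 2 * (1 + m%:R * e0).
  apply: (le_trans q3).
  have -> : 8 * m%:R * (1 + m%:R * e0) * (beta * t) ^+ 2 =
    8 * (1 + m%:R * e0) * (m%:R * (beta * t) ^+ 2) by ring.
  have -> : 2 * (1 + m%:R * e0) = 8 * (1 + m%:R * e0) * 4^-1 by field.
  by apply: ler_wpM2l => //; rewrite mulr_ge0// addr_ge0// mulr_ge0.
have : sqnorm delta <= beta * (2 * (1 + m%:R * e0)).
  by apply: le_trans cd _; rewrite ler_pM2l.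
lra.
Qed.

(** * Error of the estimated basis functions *)

Section gram_family.
Context d (T : measurableType d) (R : realType) (Q : probability T R).
Context (m : nat) (psi : 'I_m -> T -> R) (M : R).
Hypothesis psiM : forall a, ae_bounded Q M (psi a).

Definition lincomb (x : 'cV[R]_m) (w : T) : R := \sum_a x a 0 * psi a w.

Lemma lincomb_bounded x : exists B, ae_bounded Q B (lincomb x).
Proof.
exists (\sum_a `|x a 0| * M); apply: ae_bounded_sum => a.
exact: ae_boundedM (ae_bounded_cst Q (lexx _)) (psiM a).
Qed.

Lemma Rintegral_mul_lincomb B f x : ae_bounded Q B f ->
  \int[Q]_w (f w * lincomb x w) = \sum_a x a 0 * \int[Q]_w (f w * psi a w).
Proof.
move=> fB; under eq_Rintegral do rewrite mulr_sumr.
have fpsi a := ae_boundedM fB (psiM a).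
rewrite (ae_bounded_Rintegral_sum _ (B := fun a => B * (`|x a 0| * M))); last first.
  move=> a; apply: ae_boundedM => //.
  exact: ae_boundedM (ae_bounded_cst Q (lexx _)) (psiM a).
apply: eq_bigr => a _; rewrite -(ae_bounded_RintegralZl _ (fpsi a)).
by apply: eq_Rintegral => w _; rewrite mulrCA.
Qed.

Lemma Rintegral_lincomb_sqr x :
  \int[Q]_w (lincomb x w ^+ 2) =
  bilin (\matrix_(a, b) \int[Q]_w (psi a w * psi b w)) x x.
Proof.
have [B xB] := lincomb_bounded x.
under eq_Rintegral do rewrite expr2.
rewrite (Rintegral_mul_lincomb _ xB) bilinE; apply: eq_bigr => a _.
under eq_Rintegral do rewrite mulrC.
rewrite (Rintegral_mul_lincomb _ (psiM a)) mulr_sumr; apply: eq_bigr => b _.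
by rewrite mxE -mulrA [_ * x b 0]mulrC.
Qed.

Lemma gram_psd x :
  0 <= bilin (\matrix_(a, b) \int[Q]_w (psi a w * psi b w)) x x.
Proof.
by rewrite -Rintegral_lincomb_sqr; apply: Rintegral_ge0 => w _; exact: sqr_ge0.
Qed.

Lemma gram_sym : (\matrix_(a, b) \int[Q]_w (psi a w * psi b w))^T =
  \matrix_(a, b) \int[Q]_w (psi a w * psi b w).
Proof.
by apply/matrixP => a b; rewrite !mxE; apply: eq_Rintegral => w _; rewrite mulrC.
Qed.

(* lincomb l is minus the orthogonal projection of f on the span of psi. *)
Lemma projection_bound B f l : ae_bounded Q B f ->
  (\matrix_(a, b) \int[Q]_w (psi a w * psi b w)) *m l =
    (\col_a (- \int[Q]_w (f w * psi a w))) ->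
  bilin (\matrix_(a, b) \int[Q]_w (psi a w * psi b w)) l l <= B ^+ 2.
Proof.
move=> fB Al; set A := \matrix_(a, b) _ in Al *.
have [Bl lB] := lincomb_bounded l.
have ffB := ae_boundedM fB fB.
have flB := ae_boundedM (ae_bounded_cst Q (lexx `|2|)) (ae_boundedM fB lB).
have llB := ae_boundedM lB lB.
have : 0 <= \int[Q]_w ((f w + lincomb l w) ^+ 2).
  by apply: Rintegral_ge0 => w _; exact: sqr_ge0.
have -> : \int[Q]_w ((f w + lincomb l w) ^+ 2) =
    \int[Q]_w (f w * f w + 2 * (f w * lincomb l w) + lincomb l w * lincomb l w).
  by apply: eq_Rintegral => w _; ring.
rewrite (ae_bounded_RintegralD (ae_boundedD ffB flB) llB).
rewrite (ae_bounded_RintegralD ffB flB) (ae_bounded_RintegralZl _ (ae_boundedM fB lB)).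
have <- : \int[Q]_w lincomb l w ^+ 2 = \int[Q]_w (lincomb l w * lincomb l w).
  by apply: eq_Rintegral => w _; rewrite expr2.
rewrite Rintegral_lincomb_sqr -/A (Rintegral_mul_lincomb _ fB).
(* The normal equations turn the cross term into minus the form at [l], so nonnegativity of the
   square reads 0 <= E f^2 - <l, l>_A. *)
have -> : \sum_a l a 0 * \int[Q]_w (f w * psi a w) = - bilin A l l.
  rewrite -[A]mul1mx -bilin_mulr Al bilinE -sumrN; apply: eq_bigr => a _.
  rewrite (bigD1 a)//= big1 ?addr0 => [|b ba]; rewrite !mxE.
    by rewrite eqxx mulr1 mulrN opprK.
  by rewrite eq_sym (negbTE ba) mulr0 mul0r.
have := le_trans (ler_norm _) (ae_bounded_Rintegral_le ffB).
rewrite expr2; lra.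
Qed.

End gram_family.

Lemma sqr_Rintegral_le d (T : measurableType d) (R : realType)
    (Q : probability T R) (B : R) (f : T -> R) :
  ae_bounded Q B f -> (\int[Q]_w f w) ^+ 2 <= \int[Q]_w (f w ^+ 2).
Proof.
move=> fB; set c := \int[Q]_w f w.
have : 0 <= \int[Q]_w ((f w - c) ^+ 2).
  by apply: Rintegral_ge0 => w _; exact: sqr_ge0.
have -> : \int[Q]_w ((f w - c) ^+ 2) =
    \int[Q]_w (f w * f w + (- 2 * c) * f w + c ^+ 2).
  by apply: eq_Rintegral => w _; ring.
have ffB := ae_boundedM fB fB.
have cfB := ae_boundedM (ae_bounded_cst Q (lexx `|- 2 * c|)) fB.
rewrite (ae_bounded_RintegralD (ae_boundedD ffB cfB) (ae_bounded_cst Q (lexx _))).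
rewrite (ae_bounded_RintegralD ffB cfB) (ae_bounded_RintegralZl _ fB).
rewrite Rintegral_prob_cst -/c.
under [X in _ -> _ <= X]eq_Rintegral do rewrite expr2.
lra.
Qed.

Lemma Lnorm2_le d (T : measurableType d) (R : realType) (Q : probability T R)
    (B q : R) (f : T -> R) :
  ae_bounded Q B f -> \int[Q]_w (f w ^+ 2) <= q ->
  ('N[Q]_2%:E[EFin \o f] <= (Num.sqrt q)%:E)%E.
Proof.
move=> fB fq; rewrite unlock /=.
have -> : (\int[Q]_w (`|(f w)%:E| `^ 2) = (\int[Q]_w (f w ^+ 2))%:E)%E.
  under [in RHS]eq_Rintegral do rewrite expr2.
  rewrite -(ae_bounded_integralE (ae_boundedM fB fB)); apply: eq_integral => w _.
  by rewrite /= powR_mulrn// -normrX ger0_norm ?sqr_ge0 ?expr2.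
rewrite poweR_EFin lee_fin powR12_sqrt; last first.
  by apply: Rintegral_ge0 => w _; exact: sqr_ge0.
exact: ler_wsqrtr.
Qed.

(** * The estimation error in terms of the coefficients *)

Section basis_error.
Context {R : realType} {p : nat} (L : nat).
Variable phi : 'I_p -> nat -> R -> R.

Definition atom (u : 'I_p * 'I_L.+1) (x : p.-tuple R) : R :=
  phi u.1 u.2 (Defs.coord u.1 x).

(* As phi_0 = 1, these products include those of one or two basis functions. *)
Definition triple (u : ('I_p * 'I_L.+1) * ('I_p * 'I_L.+1) * ('I_p * 'I_L.+1))
  (x : p.-tuple R) : R := atom u.1.1 x * atom u.1.2 x * atom u.2 x.

Lemma phi1_atom i (l : 'I_L) : phi1 phi i l = atom (i, lift ord0 l).
Proof. by apply/funext => x; rewrite /phi1 /atom. Qed.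

Lemma phi_pair_atom i j (a : 'I_(L + L)) : exists u, phi_pair phi i j a = atom u.
Proof.
by rewrite /phi_pair; case: fintype.split => k; rewrite phi1_atom; eexists.
Qed.

Lemma phi2_uncenteredE E i j (li lj : 'I_L) x :
  phi2_uncentered phi E i j li lj x = phi1 phi i li x * phi1 phi j lj x +
    lincomb (phi_pair phi i j) (lambda phi E i j li lj) x.
Proof.
rewrite /phi2_uncentered -addrA /lincomb big_split_ord/=; congr (_ + (_ + _)).
  by apply: eq_bigr => k _; rewrite /phi_pair -[lshift L k]/(unsplit (inl k)) unsplitK.
by apply: eq_bigr => k _; rewrite /phi_pair -[rshift L k]/(unsplit (inr k)) unsplitK.
Qed.

Lemma empirical_meanD n1 (xs : 'I_n1 -> p.-tuple R) (f g : p.-tuple R -> R) :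
  empirical_mean xs (fun x => f x + g x) =
  empirical_mean xs f + empirical_mean xs g.
Proof. by rewrite /empirical_mean big_split mulrDr. Qed.

Lemma empirical_mean_lincomb n1 (xs : 'I_n1 -> p.-tuple R) m
    (psi : 'I_m -> p.-tuple R -> R) (l : 'cV[R]_m) :
  empirical_mean xs (lincomb psi l) =
  \sum_a l a 0 * empirical_mean xs (psi a).
Proof.
rewrite /empirical_mean exchange_big mulr_sumr; apply: eq_bigr => a _.
by rewrite -mulr_sumr mulrCA.
Qed.

Variable PX : probability (p.-tuple R) R.

(** By (a + b)^2 <= 2 a^2 + 2 b^2 this dominates the squared L^2 error of [phi2]. Being an explicit
    real function of the coefficients, it supplies the measurable events that control [zeta]. *)
Definition phi2_error (E : (p.-tuple R -> R) -> R) (i j : 'I_p)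
    (li lj : 'I_L) : R :=
  let delta := lambda phi E i j li lj - lambda phi (mean PX) i j li lj in
  2 * bilin (gram L phi (mean PX) i j) delta delta +
  2 * (phi2_const phi E i j li lj - phi2_const phi (mean PX) i j li lj) ^+ 2.

Variable M : R.
Hypothesis phi0 : forall i t, phi i 0%N t = 1.
Hypothesis atomM : forall u, ae_bounded PX M (atom u).

Let phi1M i (l : 'I_L) : ae_bounded PX M (phi1 phi i l).
Proof. by rewrite phi1_atom. Qed.

Let pairM i j (a : 'I_(L + L)) : ae_bounded PX M (phi_pair phi i j a).
Proof. by have [u ->] := phi_pair_atom i j a. Qed.

Lemma atom0 i x : atom (i, ord0) x = 1.
Proof. by rewrite /atom /= phi0. Qed.

Lemma gramE i j : gram L phi (mean PX) i j =
  \matrix_(a, b) \int[PX]_w (phi_pair phi i j a w * phi_pair phi i j b w).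
Proof. by []. Qed.

Lemma Lnorm_phi2_le E i j (li lj : 'I_L) :
  ('N[PX]_2%:E[EFin \o (fun x => phi2 phi E i j li lj x -
                          phi2 phi (mean PX) i j li lj x)%R]
   <= (Num.sqrt (phi2_error E i j li lj))%:E)%E.
Proof.
rewrite /phi2_error; set delta := _ - _; set kappa := _ - _.
have [B dB] := lincomb_bounded (pairM i j) delta.
have kB := ae_bounded_cst PX (lexx `|kappa|).
have -> : (fun x => phi2 phi E i j li lj x - phi2 phi (mean PX) i j li lj x) =
    (fun x => lincomb (phi_pair phi i j) delta x + kappa).
  apply/funext => x; rewrite /phi2 !phi2_uncenteredE /kappa.
  have -> : lincomb (phi_pair phi i j) delta x =
      lincomb (phi_pair phi i j) (lambda phi E i j li lj) x -
      lincomb (phi_pair phi i j) (lambda phi (mean PX) i j li lj) x.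
    rewrite /lincomb -sumrB; apply: eq_bigr => a _.
    by rewrite /delta !mxE mulrDl mulNr.
  lra.
apply: Lnorm2_le (ae_boundedD dB kB) _.
have ddB := ae_boundedM dB dB.
have kkB := ae_bounded_cst PX (lexx `|2 * kappa ^+ 2|).
have d2B := ae_boundedM (ae_bounded_cst PX (lexx `|2|)) ddB.
rewrite gramE -(Rintegral_lincomb_sqr (pairM i j)).
have -> : 2 * \int[PX]_w (lincomb (phi_pair phi i j) delta w ^+ 2) +
    2 * kappa ^+ 2 = \int[PX]_w (2 * (lincomb (phi_pair phi i j) delta w *
      lincomb (phi_pair phi i j) delta w) + 2 * kappa ^+ 2).
  rewrite (ae_bounded_RintegralD d2B kkB) (ae_bounded_RintegralZl _ ddB).
  by rewrite Rintegral_prob_cst; congr (_ * _ + _).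
apply: le_Rintegral => //.
- have := ae_bounded_integrable (ae_boundedM (ae_boundedD dB kB) (ae_boundedD dB kB)).
  by congr (_.-integrable _ _); apply/funext => w /=; rewrite expr2.
- exact: ae_bounded_integrable (ae_boundedD d2B kkB).
move=> w _; set z := lincomb _ _ _; have := sqr_ge0 (z - kappa); lra.
Qed.

Lemma zeta_le n1 (xs : 'I_n1 -> p.-tuple R) q :
  (forall i j (li lj : 'I_L), i != j ->
     phi2_error (empirical_mean xs) i j li lj <= q) ->
  (zeta L PX phi xs <= (Num.sqrt q)%:E)%E.
Proof.
move=> errq; apply: ub_ereal_sup => _ [u _ <-]; case: u => [[i l]|[ij [li lj]]] /=.
  under eq_Lnorm do rewrite /= subrr.
  by rewrite Lnorm0// lee_fin sqrtr_ge0.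
apply: le_trans (Lnorm_phi2_le _ _ _ _ _) _; rewrite lee_fin ler_wsqrtr// errq//.
exact: (valP ij).
Qed.

(** An empty supremum would be [-oo], of absolute value [+oo]; a first-order function provides an
    element. *)
Lemma zeta_ge0 n1 (xs : 'I_n1 -> p.-tuple R) : (0 < p)%N -> (0 < L)%N ->
  (0 <= zeta L PX phi xs)%E.
Proof.
move=> p0 L0; pose u : basis_index L := inl (Ordinal p0, Ordinal L0).
apply: le_trans (ereal_sup_ubound (ex_intro2 _ _ u I erefl)).
exact: Lnorm_ge0.
Qed.

End basis_error.

(** The constant beta of the coercivity inequality: the dimension times the bound of [invmx_bound],
    for Gram entries at most M^2 and a determinant at least [c]. *)
Definition inverse_gram_bound (R : realType) (L : nat) (M c : R) : R :=
  (L + L)%:R * (c^-1 * ((L + L).-1`!%:R * (M * M) ^+ (L + L).-1)).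

(** Here [e0] bounds the second moment of a product of two basis functions. The error on the
    constant splits into three terms, whose squares enter with factor 2 * 3 = 6. One of them is
    dominated by the form of delta, which is thus counted 2 + 6 = 8 times, each with the factor 8 of
    [perturbed_solution]. *)
Definition error_constant (R : realType) (L : nat) (M : R) : R :=
  let m := (L + L)%:R in let e0 := (M * M) ^+ 2 in
  64 * m * (1 + m * e0) + 6 * (1 + m * (2 * e0 + 4 * (1 + m * e0))).

Section error_bound.
Context {R : realType} {p : nat} (L : nat) (hL : (0 < L)%N).
Context (phi : 'I_p -> nat -> R -> R) (PX : probability (p.-tuple R) R) (M : R).
Hypothesis phi0 : forall i t, phi i 0%N t = 1.
Hypothesis atomM : forall u, ae_bounded PX M (atom (L := L) phi u).
Hypothesis M1 : 1 <= M.

Lemma inverse_gram_bound_ge1 c : 0 < c -> c <= 1 -> 1 <= inverse_gram_bound L M c.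
Proof.
move=> c0 c1; rewrite /inverse_gram_bound.
rewrite mulr_ege1 ?ler1n ?addn_gt0 ?hL// mulr_ege1 ?invf_ge1//.
by rewrite mulr_ege1 ?ler1n ?fact_gt0// exprn_ege1// mulr_ege1.
Qed.

Lemma phi2_error_le n1 (xs : 'I_n1 -> p.-tuple R) (i j : 'I_p)
    (li lj : 'I_L) (c t : R) :
  (forall u, `|empirical_mean xs (triple (L := L) phi u) -
              mean PX (triple (L := L) phi u)| <= t) ->
  0 < c -> c <= 1 -> c <= \det (gram L phi (mean PX) i j) -> 0 <= t ->
  t * (L + L)%:R * inverse_gram_bound L M c <= 2^-1 ->
  phi2_error phi PX (empirical_mean xs) i j li lj <=
    error_constant L M * (inverse_gram_bound L M c * t) ^+ 2.
Proof.
move=> dev c0 c1 cdet t0 small; set beta := inverse_gram_bound L M c in small *.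
set E' := empirical_mean xs in dev *; pose E := mean PX.
have phi1M i' (l : 'I_L) : ae_bounded PX M (phi1 phi i' l).
  by rewrite phi1_atom.
pose psi := phi_pair (L := L) phi i j.
have psiM a : ae_bounded PX M (psi a).
  by rewrite /psi; have [u ->] := phi_pair_atom phi i j a.
have M0 : 0 <= M by rewrite (le_trans ler01).
set A := gram L phi E i j in cdet; pose Ah := gram L phi E' i j.
pose D := gram_rhs phi E i j li lj; pose Dh := gram_rhs phi E' i j li lj.
have AG a b : `|A a b| <= M * M.
  by rewrite mxE; exact: ae_bounded_Rintegral_le (ae_boundedM (psiM a) (psiM b)).
have uA : A \in unitmx by rewrite unitmxE unitfE gt_eqF// (lt_le_trans c0).
have beta1 : 1 <= beta by exact: inverse_gram_bound_ge1.
have beta0 : 0 < beta by exact: lt_le_trans beta1.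
have coer : forall x, sqnorm x <= beta * bilin A x x.
  apply: coercive_invmx => //; [exact: gram_sym|exact: gram_psd psiM|].
  exact: invmx_bound.
pose l := lambda phi E i j li lj; pose lh := lambda phi E' i j li lj.
have lE : l = invmx A *m D by rewrite /l /lambda -/A uA.
have Al : A *m l = D by rewrite lE mulKVmx.
pose ff x := phi1 phi i li x * phi1 phi j lj x.
have ffM : ae_bounded PX (M * M) ff by exact: ae_boundedM.
have le0 : bilin A l l <= (M * M) ^+ 2 by exact: (projection_bound psiM ffM).
pose one : 'I_p * 'I_L.+1 := (i, ord0).
have psi_dev a : `|E' (psi a) - E (psi a)| <= t.
  rewrite /psi; have [u ->] := phi_pair_atom phi i j a.
  have -> : atom phi u = triple phi (u, one, one); last exact: dev.
  by apply/funext => x; rewrite /triple /= !(atom0 _ phi0) !mulr1.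
have ff_dev : `|E' ff - E ff| <= t.
  have -> : ff = triple phi ((i, lift ord0 li), (j, lift ord0 lj), one).
    by apply/funext => x; rewrite /triple /ff !phi1_atom /= (atom0 _ phi0) mulr1.
  exact: dev.
have A_dev a b : `|(Ah - A) a b| <= t.
  rewrite !mxE; have [u ->] := phi_pair_atom phi i j a.
  have [v ->] := phi_pair_atom phi i j b.
  have -> : (fun x => atom phi u x * atom phi v x) = triple phi (u, v, one).
    by apply/funext => x; rewrite /triple /= (atom0 _ phi0) mulr1.
  exact: dev.
have D_dev a : `|(Dh - D) a 0| <= t.
  rewrite !mxE -opprD normrN; have [u ->] := phi_pair_atom phi i j a.
  by rewrite !phi1_atom; exact: (dev ((i, lift ord0 li), (j, lift ord0 lj), u)).
have [uAh q lh2] := perturbed_solution coer beta1 Al le0 A_dev D_dev t0 small.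
have lhE : lh = invmx Ah *m Dh by rewrite /lh /lambda -/Ah uAh.
rewrite -lhE in q lh2.
rewrite /phi2_error -/E -/A -/l -/lh.
set delta := lh - l in q *.
set m := (L + L)%:R in small q lh2; set e0 := (M * M) ^+ 2 in le0 q lh2.
have m0 : 0 <= m by rewrite /m.
have e00 : 0 <= e0 by exact: sqr_ge0.
(* The change of the constant is split so that [s] carries the error on lambda under exact means,
   controlled by the form of delta, and [r] the error on the means weighted by the estimated lambda,
   whence the need for a bound on [sqnorm lh]. *)
set s := \sum_a delta a 0 * E (psi a).
set r := \sum_a lh a 0 * (E' (psi a) - E (psi a)).
have constE : phi2_const phi E' i j li lj - phi2_const phi E i j li lj =
    - (E' ff - E ff + r + s).
  rewrite /phi2_const.
  have -> : phi2_uncentered phi E' i j li lj = fun x => ff x + lincomb psi lh x.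
    by apply/funext => x; exact: phi2_uncenteredE.
  have -> : phi2_uncentered phi E i j li lj = fun x => ff x + lincomb psi l x.
    by apply/funext => x; exact: phi2_uncenteredE.
  have [B lB] := lincomb_bounded psiM l.
  have -> : E (fun x => ff x + lincomb psi l x) =
      E ff + \sum_a l a 0 * E (psi a).
    rewrite /E /mean (ae_bounded_RintegralD ffM lB); congr (_ + _).
    have := Rintegral_mul_lincomb psiM l (ae_bounded_cst PX (lexx `|1|)).
    under eq_Rintegral do rewrite mul1r.
    move=> ->; apply: eq_bigr => a _; congr (_ * _).
    by apply: eq_Rintegral => w _; rewrite mul1r.
  have -> : E' (fun x => ff x + lincomb psi lh x) =
      E' ff + \sum_a lh a 0 * E' (psi a).
    by rewrite -empirical_mean_lincomb; exact: empirical_meanD.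
  have -> : \sum_a l a 0 * E (psi a) = \sum_a lh a 0 * E (psi a) - s.
    rewrite /s -sumrB; apply: eq_bigr => a _; rewrite !mxE; ring.
  have -> : r = \sum_a lh a 0 * E' (psi a) - \sum_a lh a 0 * E (psi a).
    rewrite /r -sumrB; apply: eq_bigr => a _; ring.
  ring.
have s2 : s ^+ 2 <= bilin A delta delta.
  have [B dB] := lincomb_bounded psiM delta.
  rewrite -(Rintegral_lincomb_sqr psiM).
  apply: le_trans (sqr_Rintegral_le dB); rewrite le_eqVlt; apply/orP; left.
  apply/eqP; congr (_ ^+ 2).
  have := Rintegral_mul_lincomb psiM delta (ae_bounded_cst PX (lexx `|1|)).
  under eq_Rintegral do rewrite mul1r.
  move=> ->; apply: eq_bigr => a _; congr (_ * _).
  by apply: eq_Rintegral => w _; rewrite mul1r.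
have sqt z : `|z| <= t -> z ^+ 2 <= t ^+ 2.
  by move=> zt; rewrite -[leLHS]ger0_norm ?sqr_ge0// normrX lerXn2r// nnegrE.
have r2 : r ^+ 2 <= m * (t ^+ 2 * ((2 * e0 + 4 * (1 + m * e0)) * beta)).
  apply: le_trans (sqr_sum_le _) _; apply: ler_wpM2l => //.
  apply: (@le_trans _ _ (t ^+ 2 * sqnorm lh)); last first.
    by apply: ler_wpM2l => //; exact: sqr_ge0.
  rewrite /sqnorm mulr_sumr; apply: ler_sum => a _; rewrite exprMn mulrC.
  by apply: ler_wpM2r; [exact: sqr_ge0|exact: sqt].
have f2 := sqt _ ff_dev.
have tri (x y z : R) : (- (x + y + z)) ^+ 2 <= 3 * (x ^+ 2 + y ^+ 2 + z ^+ 2).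
  have := sqr_ge0 (x - y); have := sqr_ge0 (y - z); have := sqr_ge0 (x - z); lra.
rewrite constE.
have bt : t ^+ 2 * beta <= (beta * t) ^+ 2.
  rewrite exprMn mulrC; apply: ler_wpM2r; first exact: sqr_ge0.
  exact: ler_eXnr.
have t2 : t ^+ 2 <= (beta * t) ^+ 2.
  apply: le_trans bt; rewrite ler_peMr//; exact: sqr_ge0.
have K1 : 0 <= m * (2 * e0 + 4 * (1 + m * e0)).
  by rewrite mulr_ge0// addr_ge0// mulr_ge0// addr_ge0// mulr_ge0.
have r3 : r ^+ 2 <= m * (2 * e0 + 4 * (1 + m * e0)) * (beta * t) ^+ 2.
  apply: (le_trans r2).
  have -> : m * (t ^+ 2 * ((2 * e0 + 4 * (1 + m * e0)) * beta)) =
    m * (2 * e0 + 4 * (1 + m * e0)) * (t ^+ 2 * beta) by ring.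
  exact: ler_wpM2l.
have := tri (E' ff - E ff) r s; rewrite /error_constant -/m -/e0.
lra.
Qed.

End error_bound.

(** * Stochastic bounds *)

Section measurability.
Context d (Omega : measurableType d) (R : realType).

(** Writing 1/y as y (y^2)^(-1) reduces the inverse to a real power of a nonnegative number, and the
    factor y gives the convention [0^-1 = 0]. *)
Lemma measurable_fun_inv (f : Omega -> R) : measurable_fun setT f ->
  measurable_fun setT (fun w => (f w)^-1).
Proof.
move=> mf.
have -> : (fun w => (f w)^-1) = (fun w => f w * (f w ^+ 2) `^ (-1)).
  apply/funext => w; rewrite powR_inv1 ?sqr_ge0// expr2.
  have [->|f0] := eqVneq (f w) 0; first by rewrite invr0 mul0r.
  by rewrite invfM mulrA divff// mul1r.
apply: measurable_funM => //.
apply: measurableT_comp (measurable_powR (-1)) _; exact: measurable_funX.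
Qed.

Lemma measurable_fun_det (m : nat) (A : Omega -> 'M[R]_m) :
  (forall a b, measurable_fun setT (fun w => A w a b)) ->
  measurable_fun setT (fun w => \det (A w)).
Proof.
move=> mA; apply: measurable_sum => s; apply: measurable_funM => //.
by apply: measurable_prod => a _.
Qed.

Lemma measurable_fun_bilin (m : nat) (A : Omega -> 'M[R]_m)
    (x y : Omega -> 'cV[R]_m) :
  (forall a b, measurable_fun setT (fun w => A w a b)) ->
  (forall a, measurable_fun setT (fun w => x w a 0)) ->
  (forall a, measurable_fun setT (fun w => y w a 0)) ->
  measurable_fun setT (fun w => bilin (A w) (x w) (y w)).
Proof.
move=> mA mx my; under eq_fun do rewrite bilinE.
apply: measurable_sum => a; apply: measurable_sum => b.
by apply: measurable_funM => //; exact: measurable_funM.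
Qed.

(* Off the invertible locus both sides vanish, because 0^-1 = 0. *)
Lemma lambdaE p L (phi : 'I_p -> nat -> R -> R) E i j (li lj : 'I_L) :
  lambda phi E i j li lj = (\det (gram L phi E i j))^-1 *:
    (\adj (gram L phi E i j) *m gram_rhs phi E i j li lj).
Proof.
rewrite /lambda; case: ifPn => [u|]; first by rewrite /invmx u scalemxAl.
by rewrite unitmxE unitfE negbK => /eqP ->; rewrite invr0 scale0r.
Qed.

Lemma measurable_phi2_error (P : probability Omega R) p L
    (phi : 'I_p -> nat -> R -> R) (PX : probability (p.-tuple R) R) n1
    (X : 'I_n1 -> {RV P >-> (p.-tuple R)}) i j (li lj : 'I_L) :
  (forall i (l : 'I_L), measurable_fun setT (phi1 phi i l)) ->
  measurable_fun setT
    (fun w => phi2_error phi PX (empirical_mean (fun r => X r w)) i j li lj).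
Proof.
move=> mphi.
have mpair (a : 'I_(L + L)) : measurable_fun setT (phi_pair phi i j a).
  by rewrite /phi_pair; case: fintype.split.
have mE (h : p.-tuple R -> R) : measurable_fun setT h ->
    measurable_fun setT (fun w => empirical_mean (fun r => X r w) h).
  move=> mh; apply: measurable_funM => //; apply: measurable_sum => r.
  exact: measurableT_comp mh (measurable_funP (X r)).
have mgram (a b : 'I_(L + L)) : measurable_fun setT
    (fun w => gram L phi (empirical_mean (fun r => X r w)) i j a b).
  by under eq_fun do rewrite mxE; apply: mE; exact: measurable_funM.
have mff := measurable_funM (mphi i li) (mphi j lj).
have mlambda a : measurable_fun setT
    (fun w => lambda phi (empirical_mean (fun r => X r w)) i j li lj a 0).
  under eq_fun do rewrite lambdaE mxE.
  apply: measurable_funM; first by apply: measurable_fun_inv; exact: measurable_fun_det.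
  under eq_fun do rewrite mxE.
  apply: measurable_sum => b; apply: measurable_funM.
    under eq_fun do rewrite mxE.
    apply: measurable_funM => //; apply: measurable_fun_det => a' b'.
    by under eq_fun do rewrite !mxE; apply: mE; exact: measurable_funM.
  under eq_fun do rewrite mxE.
  by apply: measurableT_comp => //; apply: mE; exact: measurable_funM.
apply: measurable_funD; apply: measurable_funM => //.
  apply: measurable_fun_bilin => // a; under eq_fun do rewrite !mxE.
    exact: measurable_funB.
  exact: measurable_funB.
apply: measurable_funX; apply: measurable_funB => //.
(* The function averaged depends itself on [w] through lambda; linearity separates the coefficients
   from empirical means of fixed functions. *)
have -> : (fun w => phi2_const phi (empirical_mean (fun r => X r w)) i j li lj) =
  (fun w => - (empirical_mean (fun r => X r w)
      (fun x => phi1 phi i li x * phi1 phi j lj x) +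
    \sum_a lambda phi (empirical_mean (fun r => X r w)) i j li lj a 0 *
      empirical_mean (fun r => X r w) (phi_pair phi i j a))).
  apply/funext => w; rewrite /phi2_const -empirical_mean_lincomb -empirical_meanD.
  by congr (- empirical_mean _ _); apply/funext => x; exact: phi2_uncenteredE.
apply: measurableT_comp => //; apply: measurable_funD; first exact: mE.
apply: measurable_sum => a; apply: measurable_funM; [exact: mlambda|exact: mE].
Qed.

(** The complementary distribution function of a real random variable tends to 0 at infinity. *)
Lemma tight (P : probability Omega R) (F : Omega -> R) (e : R) :
  measurable_fun setT F -> 0 < e ->
  exists2 K : R, 0 <= K & (P [set w | (K < F w)%R] <= e%:E)%E.
Proof.
move=> mF e0.
pose Fmix := isMeasurableFun.Build _ _ _ _ F mF.
pose Frv : {RV P >-> R} := HB.pack F Fmix.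
have := cvg_ccdfy0 Frv => /fine_cvgP[_ /cvgr0Pnorm_le /(_ e e0) [K [_ hK]]].
have K1 : K < `|K| + 1 by rewrite (le_lt_trans (ler_norm K))// ltrDl.
exists (`|K| + 1); first by rewrite addr_ge0.
have setE : [set w | `|K| + 1 < F w] = F @^-1` `]`|K| + 1, +oo[.
  by apply/seteqP; split => w; rewrite /= in_itv/= andbT.
have mS : measurable [set w | `|K| + 1 < F w].
  by rewrite setE -[X in measurable X]setTI; exact: (mF measurableT _ (measurable_itv _)).
rewrite -[leLHS]fineK ?fin_num_measure// lee_fin.
apply: le_trans (ler_norm _) _.
by have := hK _ K1; rewrite /ccdf /distribution /pushforward /= -setE.
Qed.

Lemma union_bound (P : probability Omega R) (I : finType) (A : I -> set Omega)
    (c : R) : (forall i, measurable (A i)) -> (forall i, (P (A i) <= c%:E)%E) ->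
  (P (\bigcup_i A i) <= (#|I|%:R * c)%:E)%E.
Proof.
move=> mA PA.
have main (s : seq I) : measurable (\big[setU/set0]_(i <- s) A i) /\
    (P (\big[setU/set0]_(i <- s) A i) <= ((size s)%:R * c)%:E)%E.
  elim: s => [|i s [ms IH]]; first by rewrite big_nil measure0 mul0r.
  rewrite big_cons; split; first exact: measurableU.
  apply: le_trans (measureU2 _ _ _) _ => //.
  by rewrite /= -natr1 mulrDl mul1r addrC EFinD leeD.
have [_] := main (enum I); rewrite -cardE; congr (P _ <= _)%E.
rewrite -bigcup_seq; apply/seteqP; split => w [i _ Aiw]; exists i => //=.
by rewrite mem_enum.
Qed.

End measurability.

Lemma powR_natr_le_eventually (R : realType) (g eta : R) : g < 0 -> 0 < eta ->
  exists N : nat, forall n : nat, (N <= n)%N -> n%:R `^ g <= eta.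
Proof.
(* The solution of x^g = eta. *)
move=> g0 eta0; pose x := eta^-1 `^ (- g)^-1.
exists (Num.trunc x).+1 => n Nn.
have n0 : 0 < n%:R :> R by rewrite ltr0n (leq_trans _ Nn).
have xn : x <= n%:R.
  by rewrite (le_trans (ltW (truncnS_gt x)))// ler_nat.
have h : eta^-1 <= n%:R `^ (- g).
  have -> : eta^-1 = x `^ (- g).
    by rewrite /x -powRrM mulVf ?powRr1 ?invr_ge0 ?ltW// oppr_eq0 lt_eqF.
  by apply: ge0_ler_powR; rewrite ?nnegrE ?powR_ge0 ?oppr_ge0// ltW.
rewrite -[g]opprK powRN -[leRHS]invrK lef_pV2// posrE ?invr_gt0//.
exact: powR_gt0.
Qed.

(** One constant must serve every sample size, while concentration acts only from some [N] on. Each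
    earlier index gets its own constant, rescaled by [a n], and their finite sum is added to [K]. *)
Lemma bigO_P_eventually (R : realType) (d : nat -> measure_display)
    (Omega : forall n, measurableType (d n))
    (P : forall n, probability (Omega n) R)
    (Z : forall n, Omega n -> \bar R) (a : nat -> R) :
  (forall n, sample_size n -> 0 < a n) ->
  (forall e : R, 0 < e -> forall n, sample_size n -> exists2 K : R, 0 <= K &
    exists B : set (Omega n), [/\ measurable B,
      [set w | (K%:E < `|Z n w|)%E] `<=` B & (P n B <= e%:E)%E]) ->
  (forall e : R, 0 < e -> exists K (N : nat), 0 <= K /\
    forall n, (N <= n)%N -> sample_size n -> exists B : set (Omega n),
      [/\ measurable B, [set w | ((K * a n)%:E < `|Z n w|)%E] `<=` B &
       (P n B <= e%:E)%E]) ->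
  bigO_P P Z a.
Proof.
move=> a0 small large e e0.
have [K [N [K0 hK]]] := large e e0.
have /choice[k hk] : forall n, exists k : R, 0 <= k /\ (sample_size n ->
    exists B : set (Omega n), [/\ measurable B,
      [set w | ((k * a n)%:E < `|Z n w|)%E] `<=` B & (P n B <= e%:E)%E]).
  move=> n; have [sn|] := pselect (sample_size n); last by exists 0.
  have [k k0 kB] := small e e0 n sn; exists (k / a n); split.
    by rewrite divr_ge0// ltW// a0.
  by rewrite divfK// gt_eqF// a0.
pose Ks := K + \sum_(n < N) k n.
have mono n (k' : R) : sample_size n -> k' <= Ks ->
    (exists B : set (Omega n), [/\ measurable B,
      [set w | ((k' * a n)%:E < `|Z n w|)%E] `<=` B & (P n B <= e%:E)%E]) ->
    exists B : set (Omega n), [/\ measurable B,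
      [set w | ((Ks * `|a n|)%:E < `|Z n w|)%E] `<=` B & (P n B <= e%:E)%E].
  move=> sn kKs [B [mB sB PB]]; exists B; split => // w /= Kw; apply: sB => /=.
  rewrite (le_lt_trans _ Kw)// lee_fin gtr0_norm ?a0//.
  by rewrite ler_pM2r// a0.
have k0 n : 0 <= k n := (hk n).1.
exists Ks => n sn; have [Nn|nN] := leqP N n.
  apply: (mono n K sn); last exact: hK.
  by rewrite lerDl sumr_ge0.
apply: (mono n (k n) sn); last exact: (hk n).2.
rewrite /Ks (bigD1 (Ordinal nN))//= addrCA lerDl addr_ge0// sumr_ge0//.
Qed.

(** There are (p (L + 1))^3 triples, each bounded by M^3; Hoeffding's inequality is applied to each
    of them. *)
Lemma deviation_event (R : realType) (p L n1 : nat) d (Omega : measurableType d)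
    (P : probability Omega R) (PX : probability (p.-tuple R) R)
    (phi : 'I_p -> nat -> R -> R) (X : 'I_n1 -> {RV P >-> (p.-tuple R)})
    (M t : R) :
  (forall u, ae_bounded PX M (atom (L := L) phi u)) -> iid_sample PX X ->
  (0 < n1)%N -> 0 < t -> t <= 4 * (M * M * M) ->
  exists B : set Omega, [/\ measurable B,
    (P B <= (2 * (p * L.+1)%:R ^+ 3 *
       expR (- (n1%:R * t ^+ 2 / (32 * (M * M * M) ^+ 2))))%:E)%E &
    forall w, ~ B w -> forall u,
      `|empirical_mean (fun r => X r w) (triple (L := L) phi u) -
        mean PX (triple (L := L) phi u)| <= t].
Proof.
move=> atomM iidX n10 t0 tM.
have triM u : ae_bounded PX (M * M * M) (triple (L := L) phi u).
  exact: (ae_boundedM (ae_boundedM (atomM u.1.1) (atomM u.1.2)) (atomM u.2)).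
pose A u := [set w | n1%:R * t <=
  `|\sum_r (triple phi u (X r w) - \int[PX]_x triple (L := L) phi u x)|].
have mA u : measurable (A u).
  rewrite -[X in measurable X]setTI; apply: measurable_fun_le => //.
  apply: measurableT_comp => //; apply: measurable_sum => r.
  apply: measurable_funB => //.
  exact: measurableT_comp (triM u).1 (measurable_funP (X r)).
exists (\bigcup_u A u); split.
- exact: fin_bigcup_measurable finite_finset (fun u _ => mA u).
- apply: le_trans (union_bound mA (fun u => hoeffding iidX (triM u) t0 tM)) _.
  rewrite !card_prod !card_ord lee_fin mulrA.
  by rewrite !natrM ![_ * 2]mulrC mulrA; apply: ler_wpM2r; rewrite ?expR_ge0//; lra.
- move=> w /= nBw u; rewrite leNgt; apply/negP => tlt; apply: nBw; exists u => //=.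
  have n1R : 0 < n1%:R :> R by rewrite ltr0n.
  rewrite /A /= sumrB sumr_const card_ord -[X in _ - X]mulr_natl.
  have -> : \sum_r triple phi u (X r w) =
      n1%:R * empirical_mean (fun r => X r w) (triple phi u).
    by rewrite /empirical_mean mulVKf// gt_eqF.
  by rewrite -mulrBr normrM gtr0_norm// ler_pM2l// ltW.
Qed.

(** The essential bound concerns the indices from 1 to [L]; [1 <= M] covers the constant function of
    index 0. *)
Lemma atom_ae_bounded (R : realType) (p L : nat)
    (PX : probability (p.-tuple R) R) (phi : 'I_p -> nat -> R -> R) (M : R) :
  (forall i, orthonormal_basis (marginal PX i) (phi i)) ->
  (forall i t, phi i 0%N t = 1) ->
  (forall i (l : 'I_L), ('N[PX]_+oo[EFin \o phi1 phi i l] <= M%:E)%E) ->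
  1 <= M -> forall u, ae_bounded PX M (atom (L := L) phi u).
Proof.
move=> hphi phi0 hM M1 [i a]; have [l ->|->] := unliftP ord0 a; last first.
  have -> : atom (L := L) phi (i, ord0) = fun=> 1.
    by apply/funext => x; exact: atom0.
  by apply: ae_bounded_cst; rewrite normr1.
rewrite -phi1_atom; split.
  have [Lphi _ _] := hphi i.
  have mphi : measurable_fun setT (phi i l.+1).
    by have /sub_Lfun_mfun := Lphi l.+1; rewrite inE.
  exact: measurableT_comp mphi (measurable_coord i).
have := hM i l; rewrite unlock /= probability_setT lte01 => hess.
by apply: filterS (ess_sup_ge PX _) => x /le_trans/(_ hess).
Qed.

Lemma error_constant_ge0 (R : realType) (L : nat) (M : R) :
  0 <= error_constant L M.
Proof.
have h : 0 <= (M * M) ^+ 2 by exact: sqr_ge0.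
by rewrite /error_constant; do ![by []|apply: addr_ge0|apply: mulr_ge0].
Qed.

Theorem theorem1 (R : realType) (L : nat) (hL : (1 <= L)%N)
    (p : nat -> nat)
    (hp : forall n, sample_size n -> (1 <= p n)%N)
    (PX : forall n, probability ((p n).-tuple R) R)
    (hPX : forall n, sample_size n -> has_lebesgue_density (PX n))
    (phi : forall n, 'I_(p n) -> nat -> R -> R)
    (hphi : forall n, sample_size n -> forall i : 'I_(p n),
       orthonormal_basis (marginal (PX n) i) (phi n i))
    (hphi0 : forall n, sample_size n -> forall i : 'I_(p n),
       forall t : R, phi n i 0%N t = 1)
    (d : nat -> measure_display) (Omega : forall n, measurableType (d n))
    (P : forall n, probability (Omega n) R)
    (X : forall n, 'I_(n./2) -> {RV (P n) >-> ((p n).-tuple R)})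
    (hX : forall n, sample_size n -> iid_sample (PX n) (X n))
    (xi theta : R) (hxi : 0 < xi <= 1) (htheta : 0 <= theta)
    (hb1 : Hb1 L PX phi) (hb2 : Hb2 p xi) (hb3 : Hb3 L PX phi theta)
    (hlt : theta < xi / 2) :
  bigO_P P
    (fun n w => zeta L (PX n) (phi n) (fun r => X n r w))
    (fun n => n%:R `^ (theta - xi / 2)).
Proof.
have [M0 hM0] := hb1; pose M := Num.max 1 M0.
have M1 : 1 <= M by rewrite /M le_max lexx.
have atomM n : sample_size n ->
    forall u, ae_bounded (PX n) M (atom (L := L) (phi n) u).
  move=> sn; apply: (atom_ae_bounded (hphi n sn) (hphi0 n sn) _ M1) => i l.
  by apply: (le_trans (hM0 n sn i l)); rewrite lee_fin /M le_max lexx orbT.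
apply: bigO_P_eventually.
- by move=> n /andP[n0 _]; rewrite powR_gt0// ltr0n.
- move=> e e0 n sn.
  pose err w (u : ('I_(p n) * 'I_(p n)) * ('I_L * 'I_L)) :=
    phi2_error (phi n) (PX n) (empirical_mean (fun r => X n r w)) u.1.1 u.1.2 u.2.1 u.2.2.
  (* A finite sum dominating all second-order errors at once, hence measurable and tight. *)
  pose F w := \sum_u `|err w u|.
  have mphi i (l : 'I_L) : measurable_fun setT (phi1 (phi n) i l).
    by rewrite phi1_atom; exact: (atomM n sn _).1.
  have mF : measurable_fun setT F.
    apply: measurable_sum => u; apply: measurableT_comp => //.
    exact: measurable_phi2_error.
  have [K K0 PK] := tight (P n) mF e0.
  exists (Num.sqrt K); first exact: sqrtr_ge0.
  exists [set w | K < F w]; split => //.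
    rewrite -[X in measurable X]setTI -[[set w | _]]/(F @^-1` [set x | K < x]).
    have -> : [set x | K < x] = `]K, +oo[%classic.
      by apply/seteqP; split => x; rewrite /= in_itv/= andbT.
    exact: mF.
  move=> w /=; rewrite ltNge; apply: contraNT => /=; rewrite -leNgt => FK.
  rewrite gee0_abs ?zeta_ge0// ?hp//.
  apply: (zeta_le (atomM n sn)) => i j li lj ij.
  apply: le_trans FK; apply: le_trans (ler_norm _) _.
  by rewrite /F (bigD1 ((i, j), (li, lj)))//= lerDl sumr_ge0.
- move=> e e0.
  (* The minimum with 1 keeps the determinant bound [c] below at most 1, so that beta is at least
     1. *)
  have [C0 C00 hdet] := hb3; pose c1 := Num.min 1 C0.
  have c10 : 0 < c1 by rewrite lt_min ltr01 C00.
  have [C C_gt0 [K0 [N0 _ hpn]]] := hb2.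
  have /andP[xi0 xi1] := hxi.
  pose m : R := (L + L)%:R.
  have m1 : 1 <= m by rewrite ler1n addn_gt0 hL.
  pose b1 := inverse_gram_bound L M c1.
  have b11 : 1 <= b1 by apply: inverse_gram_bound_ge1; rewrite // ge_min lexx.
  pose K' := `|K0| + 1.
  pose S := 2 * (K' * L.+1%:R) ^+ 3.
  have K'0 : 0 < K' by rewrite ltr_wpDl.
  have S0 : 0 < S by rewrite mulr_gt0// exprn_gt0// mulr_gt0.
  pose M3 := M * M * M.
  have M31 : 1 <= M3 by rewrite !mulr_ege1.
  (* With y = n^(1 - xi), the Hoeffding exponent is tau^2 y / (64 M3^2) = (3 C + S / e) y. The term
     3 C cancels the growth of p^3 in the union bound, and S / e brings the remaining S exp(- (S /
     e) y) below [e]. *)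
  pose tau := Num.sqrt (64 * M3 ^+ 2 * (3 * C + S / e)).
  have arg0 : 0 < 64 * M3 ^+ 2 * (3 * C + S / e).
    rewrite mulr_gt0//; first by rewrite mulr_gt0// exprn_gt0// (lt_le_trans ltr01).
    by rewrite addr_gt0// ?divr_gt0// mulr_gt0.
  have tau0 : 0 < tau by rewrite sqrtr_gt0.
  have tau2 : tau ^+ 2 = 64 * M3 ^+ 2 * (3 * C + S / e) by rewrite sqr_sqrtr// ltW.
  have m0 : 0 < m by exact: lt_le_trans m1.
  have b10 : 0 < b1 by exact: lt_le_trans b11.
  have tmb0 : 0 < tau * m * b1 by apply: mulr_gt0 => //; exact: mulr_gt0.
  have gneg : theta - xi / 2 < 0 by rewrite subr_lt0.
  have eta0 : 0 < 2^-1 / (tau * m * b1).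
    by apply: divr_gt0 => //; rewrite invr_gt0.
  (* As theta < xi/2, beta t tends to 0; from [N1] on it meets the smallness condition of
     [phi2_error_le]. *)
  have [N1 hN1] := powR_natr_le_eventually gneg eta0.
  exists (Num.sqrt (error_constant L M) * (b1 * tau)), (maxn N0 N1); split.
    by rewrite mulr_ge0 ?sqrtr_ge0// mulr_ge0// ltW// (lt_le_trans ltr01).
  move=> n; rewrite geq_max => /andP[nN0 nN1] sn.
  have /andP[n0 nodd] := sn.
  have nR : 0 < n%:R :> R by rewrite ltr0n.
  pose t := tau * n%:R `^ (- (xi / 2)).
  have t0 : 0 < t by rewrite mulr_gt0// powR_gt0.
  pose c := c1 * n%:R `^ (- theta).
  have c0 : 0 < c by rewrite mulr_gt0// powR_gt0.
  have n1R : 1 <= n%:R :> R by rewrite ler1n.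
  have pow1 (x : R) : 0 <= x -> 1 <= n%:R `^ x.
    by move=> x0; rewrite -[leLHS](powRr0 n%:R) ler_powR.
  have c_le1 : c <= 1.
    apply: mulr_ile1; [exact: ltW|exact: powR_ge0|by rewrite ge_min lexx|].
    by rewrite powRN invf_le1 ?powR_gt0// pow1.
  have betaE : inverse_gram_bound L M c = b1 * n%:R `^ theta.
    rewrite /b1 /inverse_gram_bound /c invfM powRN invrK; ring.
  have btE : inverse_gram_bound L M c * t = b1 * tau * n%:R `^ (theta - xi / 2).
    rewrite betaE /t powRD; last by rewrite (gt_eqF nR) implybT.
    ring.
  have small : t * m * inverse_gram_bound L M c <= 2^-1.
    have -> : t * m * inverse_gram_bound L M c = tau * m * b1 * n%:R `^ (theta - xi / 2).
      by rewrite mulrAC [t * _]mulrC btE; ring.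
    by rewrite mulrC -ler_pdivlMr//; exact: hN1.
  (* Since m and beta are at least 1, the same smallness puts [t] in the range of Hoeffding's
     inequality. *)
  have t_le : t <= 4 * (M * M * M).
    apply: (@le_trans _ _ (t * m * inverse_gram_bound L M c)).
      rewrite -mulrA; apply: ler_peMr; first exact: ltW.
      by apply: mulr_ege1 => //; exact: inverse_gram_bound_ge1.
    apply: (le_trans small); rewrite -/M3; lra.
  have n1pos : (0 < n./2)%N by case: (n) n0 nodd => [|[]].
  have [B [mB PB hB]] := deviation_event (atomM n sn) (hX n sn) n1pos t0 t_le.
  exists B; split => //.
    move=> w /=; apply: contraPP => nBw; apply/negP; rewrite -leNgt.
    rewrite gee0_abs ?zeta_ge0// ?hp//.
    have -> : Num.sqrt (error_constant L M) * (b1 * tau) * n%:R `^ (theta - xi / 2) =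
        Num.sqrt (error_constant L M * (inverse_gram_bound L M c * t) ^+ 2).
      rewrite sqrtrM ?error_constant_ge0// sqrtr_sqr btE ger0_norm ?mulrA//.
      by apply: mulr_ge0; [apply: mulr_ge0; exact: ltW|exact: powR_ge0].
    apply: (zeta_le (atomM n sn)) => i j li lj ij.
    apply: (phi2_error_le hL (hphi0 n sn) (atomM n sn) M1 li lj (hB w nBw)) => //.
    + apply: le_trans (hdet n sn i j ij); rewrite /c ler_wpM2r ?powR_ge0//.
      by rewrite ge_min lexx orbT.
    + exact: ltW.
  apply: (le_trans PB); rewrite lee_fin.
  pose y := n%:R `^ (1 - xi).
  have y1 : 1 <= y by apply: pow1; rewrite subr_ge0.
  have n2 : n%:R = 2 * n./2%:R :> R.
    by rewrite -natrM mul2n -[in LHS](odd_double_half n) (negbTE nodd).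
  have n1t2 : n./2%:R * t ^+ 2 = tau ^+ 2 * y / 2.
    have -> : y = 2 * n./2%:R * (n%:R `^ (- (xi / 2))) ^+ 2.
      rewrite -n2 -powR_mulrn ?powR_ge0// -powRrM /y powRD ?(gt_eqF nR) ?implybT//.
      by rewrite powRr1 ?ltW//; congr (_ * _ `^ _); field.
    by rewrite /t; field.
  have -> : n./2%:R * t ^+ 2 / (32 * (M * M * M) ^+ 2) = (3 * C + S / e) * y.
    have M30 : M3 != 0 by rewrite gt_eqF// (lt_le_trans ltr01).
    by rewrite n1t2 tau2 -/M3; field; rewrite M30 gt_eqF.
  have pK : (p n * L.+1)%:R <= K' * L.+1%:R * expR (C * y).
    rewrite natrM mulrAC; apply: ler_wpM2r => //.
    apply: (le_trans (hpn n nN0 sn)); rewrite ler_wpM2r ?expR_ge0//.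
    by rewrite (le_trans (ler_norm _))// lerDl.
  apply: (@le_trans _ _ (2 * (K' * L.+1%:R * expR (C * y)) ^+ 3 *
      expR (- ((3 * C + S / e) * y)))).
    rewrite ler_wpM2r ?expR_ge0// ler_wpM2l// lerXn2r// nnegrE//.
    by rewrite !mulr_ge0// ?expR_ge0// ltW.
  have -> : 2 * (K' * L.+1%:R * expR (C * y)) ^+ 3 *
      expR (- ((3 * C + S / e) * y)) = S * expR (- (S / e * y)).
    rewrite exprMn mulrA -/S -mulrA; congr (_ * _).
    rewrite -expRM_natl -expRD; congr expR; ring.
  have se0 : 0 < S / e by rewrite divr_gt0.
  (* The new bound equals [e]. It is reached through exp(z) >= z at z = (S / e) y, where y >= 1
     because xi <= 1. *)
  apply: (@le_trans _ _ (S * (S / e)^-1)); last first.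
    by rewrite invfM invrK mulrA divff ?gt_eqF// mul1r.
  rewrite ler_pM2l// expRN lef_pV2 ?posrE ?expR_gt0//.
  apply: (@le_trans _ _ (S / e * y)); first by rewrite ler_peMr// ltW.
  by apply: le_trans (expR_ge1Dx _); rewrite lerDr.
Qed.
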